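(* Let $(W,S)$ be a Coxeter system of universal type (i.e. $m_{st}=\infty$ for all $s\neq t\in S$) of finite rank at least $3$, and let $r,s,t\in S$ be pairwise distinct. For each $n\in\mathbb{N}\cup\{\infty\}$, $\mathcal{M}_{\mathrm{nil}}(n)$ is a Weyl-invariant commutator blueprint of type $(W,S)$. Moreover, for the groups $U_w$ ($w\in W$) associated with $\mathcal{M}_{\mathrm{nil}}(n)$ the following hold: (i) If $n\in\mathbb{N}$ with $n\geq 3$, then every group $U_w$ is nilpotent of class at most $n-1$, but not all are nilpotent of class at most $n-2$. (ii) If $n=\infty$, then for every $m\in\mathbb{N}$ there exists $w_m\in W$ such that $U_{w_m}$ is not nilpotent of class at most $m$.
   Context: Galleries and roots. Let $(W,S)$ be a Coxeter system of finite rank with length function $\ell$; $m_{st}$ is the order of $st$. Elements of $W$ are called chambers. A gallery is a sequence $(w_0,\ldots,w_n)$ of chambers with $s_i:=w_{i-1}^{-1}w_i\in S$; $(s_1,\ldots,s_n)$ is its type; it is minimal if $\ell(w_0^{-1}w_n)=n$. For $s\in S$ put $\alpha_s=\{w\in W\mid \ell(sw)>\ell(w)\}$. A root is a set $v\alpha_s$ with $v\in W,s\in S$; $\Phi$ is the set of roots, $\Phi_+$ the set of roots containing $1_W$, $-\alpha=W\setminus\alpha$. A pair $\{\alpha,\beta\}$ of roots is prenilpotent if $\alpha\cap\beta\neq\emptyset\neq(-\alpha)\cap(-\beta)$; then $[\alpha,\beta]=\{\gamma\in\Phi\mid\alpha\cap\beta\subseteq\gamma,\ (-\alpha)\cap(-\beta)\subseteq-\gamma\}$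 and $(\alpha,\beta)=[\alpha,\beta]\setminus\{\alpha,\beta\}$. A minimal gallery $(c_0,\ldots,c_k)$ crosses the sequence of roots $(\alpha_1,\ldots,\alpha_k)$, where $\alpha_i$ is the unique root with $c_{i-1}\in\alpha_i$, $c_i\notin\alpha_i$; it is then called a minimal gallery between $\alpha_1$ and $\alpha_k$. $\mathrm{Min}$ is the set of minimal galleries starting at $1_W$, and $\mathrm{Min}(w)$ the set of those ending at $w$. For $w\in W$ with $\ell(sw)=\ell(w)-1$, $\mathrm{Min}_s(w)$ is the set of $G\in\mathrm{Min}(w)$ whose type begins with $s$; if $\ell(sw)=\ell(w)+1$, $\mathrm{Min}_s(w)=\mathrm{Min}(w)$. For $G=(c_0,\ldots,c_k)\in\mathrm{Min}_s(w)$ put $sG=(sc_1,\ldots,sc_k)$ if $\ell(sw)=\ell(w)-1$ and $sG=(1_W,sc_0,\ldots,sc_k)$ if $\ell(sw)=\ell(w)+1$. For $w\in W$ let $\Phi(w)=\{\alpha\in\Phi_+\mid w\notin\alpha\}$. For $G\in\mathrm{Min}$ crossing $(\alpha_1,\ldots,\alpha_k)$ let $\Phi(G)=\{\alpha_1,\ldots,\alpha_k\}$, ordered by $\alpha_1\leq_G\cdots\leq_G\alpha_k$ (so $\Phi(G)=\Phi(w)$ for $G\in\mathrm{Min}(w)$). Let $\mathcal{I}=\{(G,\alpha,\beta)\in\mathrm{Min}\times\Phi_+\times\Phi_+\mid\alpha,\beta\in\Phi(G),\ \alpha\leq_G\beta\}$. Given a family $(M_{\alpha,\beta}^G)_{(G,\alpha,\beta)\in\mathcal{I}}$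 of subsets $M_{\alpha,\beta}^G\subseteq(\alpha,\beta)$ ordered via $\leq_G$, products $\prod_{\gamma\in M_{\alpha,\beta}^G}u_\gamma$ are taken in increasing order with respect to $\leq_G$, $[x,y]=x^{-1}y^{-1}xy$, and $U_w$ is the group with generators $u_\alpha$ ($\alpha\in\Phi(w)$) and relations $u_\alpha^2=1$ ($\alpha\in\Phi(w)$) and $[u_\alpha,u_\beta]=\prod_{\gamma\in M_{\alpha,\beta}^G}u_\gamma$ for all $(G,\alpha,\beta)\in\mathcal{I}$ with $G\in\mathrm{Min}(w)$. A commutator blueprint of type $(W,S)$ is such a family satisfying: (CB1) if $G=(c_0,\ldots,c_k)\in\mathrm{Min}$ and $H=(c_0,\ldots,c_m)$ with $1\leq m\leq k$, then $M_{\alpha,\beta}^H=M_{\alpha,\beta}^G$ for all $\alpha\leq_H\beta$ in $\Phi(H)$; (CB2) if $s\neq t\in S$, $m_{st}<\infty$, and $(G,\alpha,\beta)\in\mathcal{I}$ with $G\in\mathrm{Min}(r_{\{s,t\}})$, where $r_{\{s,t\}}$ is the longest element of $\langle s,t\rangle$, then $M_{\alpha,\beta}^G=(\alpha,\beta)$ if $\{\alpha,\beta\}=\{\alpha_s,\alpha_t\}$ and $M_{\alpha,\beta}^G=\emptyset$ otherwise; (CB3) $|U_w|=2^{\ell(w)}$ for all $w\in W$. It is Weyl-invariant if $M_{s\alpha,s\beta}^{sG}=\{s\gamma\mid\gamma\in M_{\alpha,\beta}^G\}$ for all $w\in W$, $s\in S$, $G\in\mathrm{Min}_s(w)$ and $\alpha\leq_G\beta$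 in $\Phi(G)\setminus\{\alpha_s\}$. The family $\mathcal{M}_{\mathrm{nil}}(n)$ (depending on the fixed $r,s,t$). For $i\in\mathbb{N}$ let $k_i$ be the alternating word $tsts\cdots$ of length $i$ (e.g. $k_3=tst$), and let $r_{i,j}$ be the word $(r,k_i,r,k_j,r)$, i.e. the concatenation of $r$, $k_i$, $r$, $k_j$, $r$. For $i_1,j_1,i_2,j_2\in\mathbb{N}$ with $1\leq i_1<j_1$, $1\leq i_2<j_2$, $j_1<j_2$, an $(i_1,j_1,i_2,j_2)$-gallery is a gallery whose type is the concatenation $(c_{j_1},c_{j_1+1},\ldots,c_{j_2})$ of the words $c_{j_1}=(s,r_{i_1,j_1},s,r_{i_1+1,j_1},\ldots,s,r_{j_1-1,j_1})$, $c_i=(s,r_{1,i},s,r_{2,i},\ldots,s,r_{i-1,i})$ for $j_1<i<j_2$, $c_{j_2}=(s,r_{1,j_2},s,r_{2,j_2},\ldots,s,r_{i_2-1,j_2},s)$. For such a gallery let $(\alpha_{i_1,j_1},\alpha_{i_1+1,j_1},\ldots,\alpha_{j_1-1,j_1},\alpha_{1,j_1+1},\ldots,\alpha_{i_2,j_2})$ be the sequence of roots it crosses, omitting those crossed in the parts $r_{i,j}$; thus $\alpha_{i,j}$ is the root crossed at the letter $s$ immediately preceding the part $r_{i,j}$, and $\alpha_{i_2,j_2}$ is the last root crossed. Put $z\leq\infty$ for all $z\in\mathbb{N}$. For $n\in\mathbb{N}\cup\{\infty\}$ and $(G,\alpha,\beta)\in\mathcal{I}$: if there is an $(i_1,j_1,i_2,j_2)$-gallery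 between $\alpha$ and $\beta$ for some $i_1,j_1,i_2,j_2$ (so $\alpha=\alpha_{i_1,j_1}$, $\beta=\alpha_{i_2,j_2}$), then $M_{\mathrm{nil}}(n)_{\alpha,\beta}^G=\{\alpha_{i_1,j_2}\}$ if $j_1=i_2$ and $j_2\leq n$, and $M_{\mathrm{nil}}(n)_{\alpha,\beta}^G=\emptyset$ otherwise; if there is no such gallery, then $M_{\mathrm{nil}}(n)_{\alpha,\beta}^G=\emptyset$. Put $\mathcal{M}_{\mathrm{nil}}(n)=(M_{\mathrm{nil}}(n)_{\alpha,\beta}^G)_{(G,\alpha,\beta)\in\mathcal{I}}$. *)

(* Defs.v *)
From HB Require Import structures.
From mathcomp Require Import all_boot finmap.
From mathcomp Require Import boolp classical_sets cardinality.

Set Implicit Arguments.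
Unset Strict Implicit.
Unset Printing Implicit Defensive.

Import Algebra.

Local Open Scope classical_set_scope.
Local Open Scope card_scope.
Local Open Scope quotient_scope.
Local Open Scope group_scope.

Definition subgroup (G : groupType) (H : set G) : Prop :=
  [/\ H 1, forall x y, H x -> H y -> H (x * y) & forall x, H x -> H x^-1].

Definition gen_subgroup (G : groupType) (A : set G) : set G :=
  smallest (@subgroup G) A.

(* Indexed from 0: [lower_central G c] is the term usually written
   gamma_(c+1)(G). *)
Fixpoint lower_central {G : groupType} (c : nat) : set G :=
  if c is c'.+1 then
    gen_subgroup [set z | exists x y : G, lower_central c' x /\ z = [~ x, y]]
  else setT.

Definition nilpotent_class_le (G : groupType) (c : nat) : Prop :=
  @lower_central G c = [set 1].

Definition has_order (G : groupType) (x : G) (n : nat) : Prop :=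
  [/\ (0 < n)%N, x ^+ n = 1
    & forall k, (0 < k)%N -> (k < n)%N -> x ^+ k <> 1].

Definition finite_order (G : groupType) (x : G) : Prop :=
  exists n, has_order x n.

(* The letter (x, false) stands for x, and (x, true) for its formal inverse. *)
Definition word (X : Type) : Type := seq (X * bool).

Definition wgen (X : Type) (x : X) : X * bool := (x, false).
Definition winv (X : Type) (x : X) : X * bool := (x, true).

(* Equality of words in the group presented by the relations u = v, R u v. *)
Inductive pres_eq (X : Type) (R : word X -> word X -> Prop) :
    word X -> word X -> Prop :=
  | pres_eq_rel u v : R u v -> pres_eq R u v
  | pres_eq_inv x b : pres_eq R [:: (x, b); (x, ~~ b)] [::]
  | pres_eq_refl u : pres_eq R u u
  | pres_eq_sym u v : pres_eq R u v -> pres_eq R v u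
  | pres_eq_trans u v w : pres_eq R u v -> pres_eq R v w -> pres_eq R u w
  | pres_eq_cat u u' v v' :
      pres_eq R u u' -> pres_eq R v v' -> pres_eq R (u ++ v) (u' ++ v').

Definition pres_eqb (X : choiceType) (R : word X -> word X -> Prop) :
  rel (word X) := fun u v => `[< pres_eq R u v >].

Lemma pres_eqb_refl (X : choiceType) (R : word X -> word X -> Prop) :
  reflexive (pres_eqb R).
Proof. by move=> u; apply/asboolP; exact: pres_eq_refl. Qed.

Lemma pres_eqb_sym (X : choiceType) (R : word X -> word X -> Prop) :
  symmetric (pres_eqb R).
Proof. by move=> u v; apply/asboolP/asboolP; exact: pres_eq_sym. Qed.

Lemma pres_eqb_trans (X : choiceType) (R : word X -> word X -> Prop) :
  transitive (pres_eqb R).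
Proof.
by move=> v u w /asboolP uv /asboolP vw; apply/asboolP; exact: pres_eq_trans vw.
Qed.

Canonical pres_equiv (X : choiceType) (R : word X -> word X -> Prop) :=
  EquivRel (pres_eqb R) (@pres_eqb_refl X R) (@pres_eqb_sym X R)
           (@pres_eqb_trans X R).

Definition presented (X : choiceType) (R : word X -> word X -> Prop) : Type :=
  {eq_quot (pres_equiv R)}.

HB.instance Definition _ (X : choiceType) (R : word X -> word X -> Prop) :=
  EqQuotient.copy (presented R) {eq_quot (pres_equiv R)}.
HB.instance Definition _ (X : choiceType) (R : word X -> word X -> Prop) :=
  Choice.copy (presented R) {eq_quot (pres_equiv R)}.

Definition word_inv (X : Type) (u : word X) : word X :=
  rev [seq (l.1, ~~ l.2) | l <- u].

Section PresentedGroup.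
Context {X : choiceType} (R : word X -> word X -> Prop).

Definition pres_class (u : word X) : presented R := (\pi_(presented R) u)%qT.

Lemma pres_classP u v : pres_class u = pres_class v <-> pres_eq R u v.
Proof.
split=> [/eqmodP/asboolP //|uv].
by apply/eqmodP/asboolP.
Qed.

Definition pres_one : presented R := pres_class [::].
Definition pres_mul (x y : presented R) : presented R :=
  pres_class (repr x ++ repr y).
Definition pres_inv (x : presented R) : presented R :=
  pres_class (word_inv (repr x)).

Lemma pres_class_repr x : pres_class (repr x) = x.
Proof. exact: reprK. Qed.

Lemma pres_repr_class u : pres_eq R (repr (pres_class u)) u.
Proof. by apply/pres_classP; rewrite pres_class_repr. Qed.

Lemma pres_mulE u v :
  pres_mul (pres_class u) (pres_class v) = pres_class (u ++ v).
Proof. by apply/pres_classP; apply: pres_eq_cat; exact: pres_repr_class. Qed.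

Lemma word_invK : involutive (@word_inv X).
Proof.
move=> u; rewrite /word_inv -map_rev revK -map_comp -[RHS]map_id.
by apply: eq_map => -[x b] /=; rewrite negbK.
Qed.

Lemma word_mulV u : pres_eq R (u ++ word_inv u) [::].
Proof.
elim: u => [|[x b] u IHu]; first exact: pres_eq_refl.
rewrite /word_inv map_cons rev_cons -cats1 catA -cat1s -!catA catA.
apply: pres_eq_trans (pres_eq_inv R x b).
rewrite -[[:: (x, b); _]]cat1s -[in X in pres_eq _ _ X](cat0s [:: (x, ~~ b)]).
rewrite catA -!catA; apply: pres_eq_cat; first exact: pres_eq_refl.
by rewrite catA; apply: pres_eq_cat => //; exact: pres_eq_refl.
Qed.

Lemma pres_mulA : associative pres_mul.
Proof.
move=> x y z; rewrite -[x]pres_class_repr -[y]pres_class_repr.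
by rewrite -[z]pres_class_repr !pres_mulE catA.
Qed.

Lemma pres_mul1 : left_id pres_one pres_mul.
Proof. by move=> x; rewrite -[x]pres_class_repr pres_mulE. Qed.

Lemma pres_mulr1 : right_id pres_one pres_mul.
Proof. by move=> x; rewrite -[x]pres_class_repr pres_mulE cats0. Qed.

Lemma pres_mulrV : right_inverse pres_one pres_inv pres_mul.
Proof.
move=> x; rewrite -[X in pres_mul X _]pres_class_repr pres_mulE.
by apply/pres_classP; exact: word_mulV.
Qed.

Lemma pres_mulV : left_inverse pres_one pres_inv pres_mul.
Proof.
move=> x; rewrite -[X in pres_mul _ X]pres_class_repr pres_mulE.
apply/pres_classP; rewrite -[X in _ ++ X]word_invK; exact: word_mulV.
Qed.

End PresentedGroup.

HB.instance Definition _ (X : choiceType) (R : word X -> word X -> Prop) :=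
  isGroup.Build (presented R) (@pres_mulA X R) (@pres_mul1 X R)
    (@pres_mulr1 X R) (@pres_mulV X R) (@pres_mulrV X R).

Inductive coxeter_rel (W : groupType) (S : {fset W}) :
    word S -> word S -> Prop :=
  | CoxeterRel (s t : S) (m : nat) : has_order (val s * val t) m ->
      coxeter_rel (flatten (nseq m [:: wgen s; wgen t])) [::].

(* S consists of involutions and W is the group generated by S subject to the
   relations (st)^m_st = 1, for those s, t (possibly equal) with m_st finite. *)
Definition coxeter_system (W : groupType) (S : {fset W}) : Prop :=
  (forall s, s \in S -> has_order s 2) /\
  exists2 f : {multiplicative presented (@coxeter_rel W S) -> W},
    bijective f & forall s : S, f (pres_class _ [:: wgen s]) = val s.

Definition universal_type (W : groupType) (S : {fset W}) : Prop :=
  forall s t, s \in S -> t \in S -> s != t -> ~ finite_order (s * t).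

Definition is_expr_length (W : groupType) (S : {fset W}) (w : W) : set nat :=
  [set n | exists u : seq W,
     [/\ all (mem S) u, size u = n & \prod_(x <- u) x = w]].

Definition len (W : groupType) (S : {fset W}) (w : W) : nat :=
  xget 0%N [set n | is_expr_length S w n /\
                    forall m, is_expr_length S w m -> (n <= m)%N].

Definition longest_in (W : groupType) (S : {fset W}) (s t w : W) : Prop :=
  gen_subgroup [set s; t] w /\
  forall v, gen_subgroup [set s; t] v -> (len S v <= len S w)%N.

Definition gallery_type (W : groupType) (G : seq W) : seq W :=
  if G is c :: cs then pairmap (fun x y => x^-1 * y) c cs else [::].

Definition gallery (W : groupType) (S : {fset W}) (G : seq W) : Prop :=
  G <> [::] /\ all (mem S) (gallery_type G).

Definition minimal_gallery (W : groupType) (S : {fset W}) (G : seq W) : Prop :=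
  gallery S G /\ len S ((head 1 G)^-1 * last 1 G) = (size G).-1.

Definition Min (W : groupType) (S : {fset W}) : set (seq W) :=
  [set G | minimal_gallery S G /\ head 1 G = 1].

Definition Min_to (W : groupType) (S : {fset W}) (w : W) : set (seq W) :=
  [set G | Min S G /\ last 1 G = w].

Definition Min_s (W : groupType) (S : {fset W}) (s w : W) : set (seq W) :=
  [set G | Min_to S w G /\
           ((len S (s * w)).+1 = len S w -> ohead (gallery_type G) = Some s)].

Definition gallery_act (W : groupType) (S : {fset W}) (s w : W) (G : seq W) :
    seq W :=
  if (len S (s * w)).+1 == len S w then [seq s * c | c <- behead G]
  else 1 :: [seq s * c | c <- G].

Definition simple_root (W : groupType) (S : {fset W}) (s : W) : set W :=
  [set w | (len S w < len S (s * w))%N].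

Definition translate (W : groupType) (v : W) (a : set W) : set W :=
  [set v * x | x in a].

Definition cox_root (W : groupType) (S : {fset W}) : set (set W) :=
  [set a | exists v s, s \in S /\ a = translate v (simple_root S s)].

Definition positive_root (W : groupType) (S : {fset W}) : set (set W) :=
  [set a | cox_root S a /\ a 1].

Definition closed_interval (W : groupType) (S : {fset W}) (a b : set W) :
    set (set W) :=
  [set c | [/\ cox_root S c, a `&` b `<=` c & ~` a `&` ~` b `<=` ~` c]].

Definition open_interval (W : groupType) (S : {fset W}) (a b : set W) :
    set (set W) :=
  closed_interval S a b `\` [set a; b].

(* The unique root containing c and not d, for adjacent chambers c and d. *)
Definition crossed_root (W : groupType) (S : {fset W}) (c d : W) : set W :=
  xget set0 [set a | [/\ cox_root S a, a c & ~ a d]].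

Definition crossed_roots (W : groupType) (S : {fset W}) (G : seq W) :
    seq (set W) :=
  if G is c :: cs then pairmap (crossed_root S) c cs else [::].

Definition gallery_between (W : groupType) (S : {fset W}) (G : seq W)
    (a b : set W) : Prop :=
  [/\ minimal_gallery S G, ohead (crossed_roots S G) = Some a
    & ohead (rev (crossed_roots S G)) = Some b].

Definition Phi (W : groupType) (S : {fset W}) (w : W) : set (set W) :=
  [set a | positive_root S a /\ ~ a w].

(* Includes the condition that a and b lie in Phi(G). *)
Definition le_gallery (W : groupType) (S : {fset W}) (G : seq W)
    (a b : set W) : Prop :=
  [/\ a \in crossed_roots S G, b \in crossed_roots S G
    & (index a (crossed_roots S G) <= index b (crossed_roots S G))%N].

Definition index_set (W : groupType) (S : {fset W}) (G : seq W)
    (a b : set W) : Prop :=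
  [/\ Min S G, positive_root S a, positive_root S b & le_gallery S G a b].

(* Only the values M G a b with [index_set S G a b] are meaningful. *)
Definition root_family (W : groupType) : Type :=
  seq W -> set W -> set W -> set (set W).

(* M G a b, listed in increasing order with respect to the order of G; when
   G is in Min(w), all of its elements lie in Phi(w), so pmap drops nothing. *)
Definition family_word (W : groupType) (S : {fset W}) (M : root_family W) (w : W)
    (G : seq W) (a b : set W) : seq (Phi S w) :=
  pmap insub [seq c <- crossed_roots S G | c \in M G a b].

Inductive U_rel (W : groupType) (S : {fset W}) (M : root_family W) (w : W) :
    word (Phi S w) -> word (Phi S w) -> Prop :=
  | U_rel_square (a : Phi S w) : U_rel M [:: wgen a; wgen a] [::]
  | U_rel_comm (G : seq W) (a b : Phi S w) :
      Min_to S w G -> index_set S G (val a) (val b) ->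
      U_rel M [:: winv a; winv b; wgen a; wgen b]
        [seq wgen c | c <- family_word S M w G (val a) (val b)].

Definition U (W : groupType) (S : {fset W}) (M : root_family W) (w : W) :
  groupType := presented (@U_rel W S M w).

Record commutator_blueprint (W : groupType) (S : {fset W}) (M : root_family W) :
    Prop := CommutatorBlueprint {
  blueprint_sub : forall G a b,
    index_set S G a b -> M G a b `<=` open_interval S a b;
  blueprint_CB1 : forall G m a b,
    Min S G -> (1 <= m)%N -> (m < size G)%N ->
    le_gallery S (take m.+1 G) a b -> M (take m.+1 G) a b = M G a b;
  blueprint_CB2 : forall s t w G a b,
    s \in S -> t \in S -> s != t -> finite_order (s * t) ->
    longest_in S s t w -> Min_to S w G -> index_set S G a b ->
    ([set a; b] = [set simple_root S s; simple_root S t] ->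
       M G a b = open_interval S a b) /\
    ([set a; b] <> [set simple_root S s; simple_root S t] ->
       M G a b = set0);
  blueprint_CB3 : forall w, [set: U S M w] #= `I_(2 ^ len S w)
}.

Definition weyl_invariant (W : groupType) (S : {fset W}) (M : root_family W) :
    Prop :=
  forall w s G a b, s \in S -> Min_s S s w G -> le_gallery S G a b ->
    a <> simple_root S s -> b <> simple_root S s ->
    M (gallery_act S s w G) (translate s a) (translate s b) =
    [set translate s c | c in M G a b].

Section NilFamily.
Context {W : groupType} (S : {fset W}) (r s t : W).

Definition alt_word (i : nat) : seq W :=
  [seq if odd p then s else t | p <- iota 0 i].

Definition r_word (i j : nat) : seq W :=
  [:: r] ++ alt_word i ++ [:: r] ++ alt_word j ++ [:: r].

(* The concatenation of the words (s, r_(i,j)) for i0 <= i < i1. *)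
Definition c_word (i0 i1 j : nat) : seq W :=
  flatten [seq s :: r_word i j | i <- index_iota i0 i1].

(* The type of an (i1,j1,i2,j2)-gallery without its last letter s. *)
Definition nil_prefix (i1 j1 i2 j2 : nat) : seq W :=
  c_word i1 j1 j1 ++ flatten [seq c_word 1 i i | i <- index_iota j1.+1 j2]
    ++ c_word 1 i2 j2.

Definition nil_gallery (i1 j1 i2 j2 : nat) (H : seq W) : Prop :=
  gallery S H /\ gallery_type H = nil_prefix i1 j1 i2 j2 ++ [:: s].

(* alpha_(i,j), for j1 < j, in an (i1,j1,i2,j2)-gallery H: the part of the type
   of H preceding the letter s at which this root is crossed is
   [nil_prefix i1 j1 i j]. *)
Definition nil_root (i1 j1 : nat) (H : seq W) (i j : nat) : set W :=
  nth set0 (crossed_roots S H) (size (nil_prefix i1 j1 i j)).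

(* [None] stands for n = infinity. The type of an (i1,j1,i2,j2)-gallery
   determines i1, j1, i2, j2, and the gallery is determined by the roots
   between which it lies, so this set has at most one element. *)
Definition M_nil (n : option nat) : root_family W := fun G a b =>
  [set c | exists i1 j1 i2 j2 H,
    [/\ [/\ (1 <= i1)%N, (i1 < j1)%N, (1 <= i2)%N, (i2 < j2)%N & (j1 < j2)%N],
        nil_gallery i1 j1 i2 j2 H,
        gallery_between S H a b,
        j1 = i2 /\ (if n is Some m then (j2 <= m)%N else true)
      & c = nil_root i1 j1 H i1 j2]].

End NilFamily.

(* Main.v *)
(* In the universal case W is a free product of groups of order 2 and its Cayley
   graph is a tree: there is exactly one minimal gallery from 1 to w, given by
   the reduced word of w, and roots correspond to directed edges.  So U_w has
   one involution per letter of this word, and the only nontrivial commutators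
   are [u_p, u_q] = u_k for those letters p < k < q that play the roles of
   alpha_(i,j), alpha_(i,l), alpha_(j,l) in an (i,j,j,l)-gallery with l <= n.

   The blocks r_(i,j) can be read off a word, so the label (i,j) of a letter
   inside a gallery is unique.  Hence the letters around a fixed one form a
   chain whose generators satisfy the relations of the elementary matrices
   e_(i,j) over F_2.

   Since [u_p, u_q] is a product of letters strictly between p and q, U_w has at
   most 2^l(w) elements; they are distinct because the coefficient of u_k in an
   ordered product is detected by a parity if u_k is not a commutator, and by
   an entry of the unitriangular matrices attached to the chain of k otherwise.
   Giving a commutator with label (i,l) the weight l - i bounds the class by
   n - 1, and u_(1,n) = [...[u_(1,2), u_(2,3)], ..., u_(n-1,n)] shows that this
   bound is attained. *)
Require Import Defs.
From mathcomp Require Import all_boot finmap.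
From mathcomp Require Import boolp classical_sets cardinality.
From mathcomp Require Import zify.

Set Implicit Arguments.
Unset Strict Implicit.
Unset Printing Implicit Defensive.

Import Algebra.

(** * Transfer of cardinality along a bijection with a finite type *)

Section Cardinality.
Local Open Scope classical_set_scope.
Local Open Scope card_scope.

Lemma card_setT_finType (T : finType) (X : Type) (g : T -> X) :
  injective g -> (forall x, exists y, g y = x) -> [set: X] #= `I_#|T|.
Proof.
move=> ginj gsurj.
have [t0 _|T0] := pickP (mem T); last first.
  rewrite eq_card0 => [|y]; last exact: T0.
  have -> : [set: X] = set0.
    by apply/seteqP; split=> // x _; have [y _] := gsurj x; have := T0 y.
  by rewrite II0.
pose f m := g (nth t0 (enum T) m).
have -> : [set: X] = [set f m | m in `I_#|T|].
  apply/seteqP; split=> // x _; have [y <-] := gsurj x.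
  exists (index y (enum T)); last by rewrite /f nth_index// mem_enum.
  by rewrite /= cardE index_mem mem_enum.
apply: inj_card_eq => a b; rewrite !inE /= => aT bT /ginj/eqP.
by rewrite nth_uniq ?enum_uniq -?cardE// => /eqP.
Qed.

End Cardinality.

(** * Presented groups, ordered products of involutions, commutator calculus *)

Section GroupLemmas.
Local Open Scope classical_set_scope.
Local Open Scope group_scope.

Lemma pres_classM (X : choiceType) (R : word X -> word X -> Prop) (u v : word X) :
  pres_class R (u ++ v) = pres_class R u * pres_class R v.
Proof. by rewrite -pres_mulE. Qed.

Lemma pres_class_winv (X : choiceType) (R : word X -> word X -> Prop) x :
  pres_class R [:: winv x] = (pres_class R [:: wgen x])^-1.
Proof.
apply: (@mulgI _ (pres_class R [:: wgen x])); rewrite mulgV -pres_classM.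
exact/pres_classP/(pres_eq_inv _ x false).
Qed.

Lemma pres_class_comm (X : choiceType) (R : word X -> word X -> Prop) x y :
  [~ pres_class R [:: wgen x], pres_class R [:: wgen y]] =
  pres_class R [:: winv x; winv y; wgen x; wgen y].
Proof.
by rewrite (pres_classM R [:: winv x] [:: winv y; wgen x; wgen y])
  (pres_classM R [:: winv y] [:: wgen x; wgen y]) (pres_classM R [:: wgen x] [:: wgen y])
  !pres_class_winv.
Qed.

Lemma pres_subgroupT (X : choiceType) (R : word X -> word X -> Prop)
    (P : set (presented R)) :
  subgroup P -> (forall x, P (pres_class R [:: wgen x])) -> P = setT.
Proof.
move=> [P1 PM PV] Pgen; apply/seteqP; split=> // z _.
rewrite -(pres_class_repr z); elim: (repr z) => [//|[x b] a IH].
rewrite -cat1s pres_classM; apply: PM => //; case: b; last exact: Pgen.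
by rewrite pres_class_winv; apply: PV.
Qed.

(** Von Dyck's theorem for actions: the Boolean of a letter can be ignored because each generator
    acts as its own inverse. *)
Lemma pres_eq_foldl (X : choiceType) (R : word X -> word X -> Prop) (V : Type)
    (act : X -> V -> V) :
  (forall x, involutive (act x)) ->
  (forall a b, R a b -> forall v,
     foldl (fun v l => act l.1 v) v a = foldl (fun v l => act l.1 v) v b) ->
  forall a b, pres_eq R a b -> forall v,
    foldl (fun v l => act l.1 v) v a = foldl (fun v l => act l.1 v) v b.
Proof.
move=> actK actR a b; elim=> {a b} //=.
- by move=> x b v; rewrite actK.
- by move=> a b c _ IH1 _ IH2 v; rewrite IH1.
- by move=> a a' b b' _ IH1 _ IH2 v; rewrite !foldl_cat IH1 IH2.
Qed.

Variable G : groupType.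
Implicit Types (A P : set G) (l : seq G).

Lemma gen_subgroup_subgroup A : subgroup (gen_subgroup A).
Proof.
split=> [P [[P1 _ _] _]//|x y Hx Hy P PA|x Hx P PA].
  by have [[_ PM _] _] := PA; apply: PM; [exact: Hx|exact: Hy].
by have [[_ _ PV] _] := PA; apply: PV; exact: Hx.
Qed.

Lemma gen_subgroup_incl A : A `<=` gen_subgroup A.
Proof. exact: sub_gen_smallest. Qed.

Lemma gen_subgroup_min A P : subgroup P -> A `<=` P -> gen_subgroup A `<=` P.
Proof. exact: smallest_sub. Qed.

(** Ordered products of subsequences of [l]: the candidates for normal forms, at most [2 ^ size l]
    of them. *)
Definition mask_prods l : set G :=
  [set z | exists2 b, size b = size l & z = \prod_(x <- mask b l) x].

Lemma mask_prods_cons x l z : mask_prods (x :: l) z <->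
  mask_prods l z \/ exists2 h, mask_prods l h & z = x * h.
Proof.
split=> [[[//|[] b] [sb] -> /=]|[[b sb ->]|[_ [b sb ->] ->]]].
- by right; exists (\prod_(y <- mask b l) y); [exists b|rewrite big_cons].
- by left; exists b.
- by exists (false :: b); rewrite //= sb.
- by exists (true :: b); rewrite /= ?sb// big_cons.
Qed.

Lemma mask_prods_mem l x : x \in l -> mask_prods l x.
Proof.
elim: l => // y l IH; rewrite in_cons => /predU1P[->|xl]; apply/mask_prods_cons.
  right; exists 1; rewrite ?mulg1//; exists (nseq (size l) false); rewrite ?size_nseq//.
  by rewrite mask_false big_nil.
by left; exact: IH.
Qed.

(** Conjugation by the involution [x] sends [y] to [y * [~ x, y]^-1], so it preserves the subgroup
    [mask_prods l]; the union of this subgroup and its coset by [x] is then closed under products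
    and inverses. *)
Lemma mask_prods_subgroup_cons x l : x * x = 1 -> subgroup (mask_prods l) ->
  (forall y, y \in l -> mask_prods l [~ x, y]) -> subgroup (mask_prods (x :: l)).
Proof.
move=> xx Hl xl; have [l1 lM lV] := Hl.
have xV : x^-1 = x by apply: mulg1_eq.
have conj h : mask_prods l h -> mask_prods l (x * h * x).
  move=> [b _ ->]; have : {subset mask b l <= l} by move=> y /mem_mask.
  elim: (mask b l) => [_|y m IH ml]; first by rewrite big_nil mulg1 xx.
  have yl : y \in l by apply: ml; rewrite mem_head.
  rewrite big_cons.
  have -> : x * (y * \prod_(j <- m) j) * x = x * y * x * (x * (\prod_(j <- m) j) * x).
    by rewrite -!mulgA (mulgA x x) xx mul1g.
  apply: (lM); last by apply: IH => z zm; apply: ml; rewrite in_cons zm orbT.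
  have -> : x * y * x = y * [~ x, y]^-1.
    by rewrite /commg /conjg !invgM !invgK !mulgA mulgV mul1g xV.
  by apply: (lM); [exact: mask_prods_mem|apply: lV; exact: xl].
have xh h : x * h = x * h * x * x by rewrite -mulgA xx mulg1.
split.
- by apply/mask_prods_cons; left.
- move=> y z /mask_prods_cons[hy|[h hh ->]] /mask_prods_cons[hz|[h' hh' ->]];
    apply/mask_prods_cons.
  + by left; exact: lM.
  + right; exists (x * y * x * h'); first by apply: (lM) => //; exact: conj.
    by rewrite !mulgA xx mul1g.
  + by right; exists (h * z); rewrite ?mulgA//; exact: lM.
  + by left; rewrite mulgA; apply: (lM) => //; exact: conj.
- move=> y /mask_prods_cons[hy|[h hh ->]]; apply/mask_prods_cons; first by left; exact: lV.
  right; exists (x * h^-1 * x); first by apply/conj/lV.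
  by rewrite invgM xV !mulgA xx mul1g.
Qed.

(** Induction over the suffixes of [l], from the empty one upwards: each commutator with the newly
    added first letter is trivial or a letter of the shorter suffix. *)
Lemma mask_prods_subgroup l :
  (forall p, (p < size l)%N -> nth 1 l p * nth 1 l p = 1) ->
  (forall p q, (p < q)%N -> (q < size l)%N -> [~ nth 1 l p, nth 1 l q] = 1 \/
     exists2 k, (p < k < size l)%N & [~ nth 1 l p, nth 1 l q] = nth 1 l k) ->
  subgroup (mask_prods l).
Proof.
move=> sq comm.
suff H d : (d <= size l)%N -> subgroup (mask_prods (drop (size l - d) l)).
  by rewrite -[l in mask_prods l]drop0 -(subnn (size l)); exact: H.
elim: d => [_|d IH dl].
  rewrite subn0 drop_size; have E z : mask_prods [::] z -> z = 1.
    by move=> [b _ ->]; rewrite mask0 big_nil.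
  split; first by exists [::]; rewrite ?mask0 ?big_nil.
    by move=> x y /E-> /E->; rewrite mulg1; exists [::]; rewrite ?mask0 ?big_nil.
  by move=> x /E->; rewrite invg1; exists [::]; rewrite ?mask0 ?big_nil.
set p := (size l - d.+1)%N.
have pl : (p < size l)%N by rewrite /p; lia.
have pS : (size l - d = p.+1)%N by rewrite /p; lia.
rewrite (drop_nth 1 pl); have {}IH := IH (ltnW dl); rewrite pS in IH.
apply: mask_prods_subgroup_cons => //; first exact: sq.
move=> y /(nthP 1)[q]; rewrite size_drop nth_drop ltn_subRL => ql <-.
have [->|[k /andP[pk kl] ->]] := comm p (p.+1 + q)%N (leq_addr q p.+1) ql.
  by case: IH.
apply/mask_prods_mem/(nthP 1); exists (k - p.+1)%N.
  by rewrite size_drop ltn_sub2r// (leq_ltn_trans pk).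
by rewrite nth_drop subnKC.
Qed.

Lemma lower_central_sub (N : nat -> set G) :
  N 0%N = setT -> (forall d, subgroup (N d)) ->
  (forall d x y, N d x -> N d.+1 [~ x, y]) ->
  forall d, lower_central d `<=` N d.
Proof.
move=> N0 sN cN; elim=> [|d IH]; first by rewrite N0.
by apply: gen_subgroup_min => // _ [x [y [/IH Nx ->]]]; exact: cN.
Qed.

Lemma lower_central_subgroup d : subgroup (@lower_central G d).
Proof. by case: d => [|d]; [split|exact: gen_subgroup_subgroup]. Qed.

(** Commutators need only be checked on generators. By [cB] the elements of [X] normalise the
    subgroup generated by [B], which is therefore normal; commutator identities then expand both
    arguments. *)
Lemma comm_gen_subgroup (X A B : set G) :
  (forall P, subgroup P -> X `<=` P -> P = setT) ->
  (forall x, X x -> x * x = 1) -> B `<=` A ->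
  (forall x y, A x -> X y -> gen_subgroup B [~ x, y]) ->
  (forall x y, B x -> X y -> gen_subgroup B [~ x, y]) ->
  forall x y, gen_subgroup A x -> gen_subgroup B [~ x, y].
Proof.
move=> Xgen X2 BA cA cB.
have [B1 BM BV] := gen_subgroup_subgroup B.
have conjB y : forall x, gen_subgroup B x -> gen_subgroup B (x ^ y).
  (* Both [y] and its inverse are required, so that the set is closed under inversion. *)
  suff : [set y | forall x, gen_subgroup B x ->
      gen_subgroup B (x ^ y) /\ gen_subgroup B (x ^ y^-1)] = setT.
    by move=> /seteqP[_ /(_ y I) h] x /h[].
  apply: Xgen.
    split=> [x|z z' hz hz' x|z hz x] Bx /=.
    - by rewrite invg1 conjg1.
    - have [h1 h2] := hz x Bx; have [h3 h4] := hz' x Bx; rewrite (invgM z z') !conjgM.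
      by split; [case: (hz' _ h1)|case: (hz _ h4)].
    - by rewrite invgK; have [] := hz x Bx.
  move=> z Xz x Bx.
  have -> : z^-1 = z by apply/mulg1_eq/X2.
  suff h : gen_subgroup B `<=` [set x | gen_subgroup B (x ^ z)] by split; exact: h.
  apply: gen_subgroup_min.
    split=> [|a b ha hb|a ha] /=; first by rewrite conj1g.
      by rewrite conjMg; exact: BM.
    by rewrite conjVg; exact: BV.
  move=> a Ba /=; have -> : a ^ z = a * [~ a, z] by rewrite commgEl mulVKg.
  by apply: (BM); [exact: gen_subgroup_incl|exact: cB].
move=> x y; move: x.
suff h : [set y | forall x, gen_subgroup A x -> gen_subgroup B [~ x, y]] = setT.
  by move/seteqP: h => [_ /(_ y I)].
have VM (a b z : G) : [~ a * b, z] = [~ a, z] ^ b * [~ b, z].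
  by rewrite /commg /conjg !invgM !mulgA; do !rewrite ?mulgK ?mulgKV ?mulgVK.
have MV (a b z : G) : [~ a, b * z] = [~ a, z] * [~ a, b] ^ z.
  by rewrite /commg /conjg !invgM !mulgA; do !rewrite ?mulgK ?mulgVK.
have cVl (a z : G) : [~ a^-1, z] = ([~ a, z]^-1) ^ a^-1.
  by rewrite /commg /conjg !invgM !invgK !mulgA; do !rewrite ?mulgK ?mulgVK ?mulgV ?mul1g.
have cVr (a z : G) : [~ a, z^-1] = ([~ a, z]^-1) ^ z^-1.
  by rewrite /commg /conjg !invgM !invgK !mulgA; do !rewrite ?mulgK ?mulgVK ?mulgV ?mul1g.
apply: Xgen.
  split=> [x Ax|z z' hz hz' x Ax|z hz x Ax]; first by rewrite commg1.
    by rewrite MV; apply: (BM); [exact: hz'|apply: conjB; exact: hz].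
  by rewrite cVr; apply: conjB; apply: (BV); exact: hz.
move=> z Xz; apply: gen_subgroup_min; last by move=> a Aa; exact: cA.
split=> [|a b ha hb|a ha] /=; first by rewrite comm1g.
  by rewrite VM; apply: (BM); [apply: conjB; exact: ha|exact: hb].
by rewrite cVl; apply: conjB; apply: (BV); exact: ha.
Qed.

End GroupLemmas.

(** * Reading blocks off the words of nil-galleries *)

Section NilWords.
Local Open Scope nat_scope.
Context (W : groupType) (r s t : W).

Local Notation alt := (alt_word s t).
Local Notation rw := (r_word r s t).
Local Notation cw := (c_word r s t).
Local Notation np := (nil_prefix r s t).

Lemma index_iota_cat i j k : i <= j <= k ->
  index_iota i k = index_iota i j ++ index_iota j k.
Proof.
move=> /andP[ij jk]; rewrite /index_iota.
have -> : k - i = (j - i) + (k - j) by lia.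
by rewrite iotaD subnKC.
Qed.

Lemma c_word_cat i j k l : i <= j <= k -> cw i k l = cw i j l ++ cw j k l.
Proof. by move=> ijk; rewrite /c_word (index_iota_cat ijk) map_cat flatten_cat. Qed.

Lemma c_wordS i j : cw i i.+1 j = s :: rw i j.
Proof. by rewrite /c_word /index_iota subSnn /= cats0. Qed.

(* The part of the infinite word c_2 c_3 c_4 ... that precedes the letter s at
   which alpha_(i,j) is crossed. *)
Definition pw i j : seq W := flatten [seq cw 1 b b | b <- index_iota 2 j] ++ cw 1 i j.

(** The position of the letter of [alpha_(i,j)] in the infinite word. The value at [i = j] is used
    as well: for [2 <= j] it is where [c_(j+1)] starts. *)
Definition off i j := size (pw i j).

Lemma pwS i j : 1 <= i -> pw i.+1 j = pw i j ++ s :: rw i j.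
Proof. by move=> i1; rewrite /pw (@c_word_cat 1 i) ?c_wordS ?catA// i1 /=. Qed.

Lemma pw_wrap j : 2 <= j -> pw j j = pw 1 j.+1.
Proof.
move=> j2; rewrite /pw [cw 1 1 _]/c_word cats0 (@index_iota_cat 2 j j.+1) ?j2 ?leqnSn//.
by rewrite map_cat flatten_cat /index_iota subSnn /= cats0.
Qed.

(** The type of a nil-gallery is a factor of one infinite word, so galleries can be compared through
    offsets. *)
Lemma pw_nil_prefix i j k l : 1 <= i -> i < j -> j < l ->
  pw i j ++ np i j k l = pw k l.
Proof.
move=> i1 ij jl; rewrite /pw /nil_prefix -!catA.
rewrite (catA (cw 1 i j)) -c_word_cat ?i1 ?(ltnW ij)//.
rewrite (@index_iota_cat 2 j l) ?(leq_trans i1 ij)//; last lia.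
rewrite map_cat flatten_cat -catA; congr cat.
rewrite (@index_iota_cat j j.+1 l) ?leqnSn// map_cat flatten_cat.
by rewrite {2}/index_iota subSnn /= cats0 catA.
Qed.

Lemma off_lt_succ i j : 1 <= i -> off i j < off i.+1 j.
Proof. by move=> i1; rewrite /off pwS// size_cat /=; lia. Qed.

Lemma off_wrap j : 2 <= j -> off j j = off 1 j.+1.
Proof. by move=> j2; rewrite /off pw_wrap. Qed.

Lemma off_leq i i' j : 1 <= i -> i <= i' -> off i j <= off i' j.
Proof.
move=> i1 /subnKC <-; elim: (i' - i) => [|k IH]; first by rewrite addn0.
by rewrite addnS (leq_trans IH)// ltnW// off_lt_succ//; lia.
Qed.

Lemma off_ltl i i' j : 1 <= i -> i < i' -> off i j < off i' j.
Proof. by move=> i1 ii'; apply: leq_trans (off_lt_succ j i1) _; apply: off_leq. Qed.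

Lemma off_leq1 j j' : 2 <= j -> j <= j' -> off 1 j <= off 1 j'.
Proof.
move=> j2 /subnKC <-; elim: (j' - j) => [|k IH]; first by rewrite addn0.
by rewrite addnS -off_wrap; [apply: leq_trans IH _; apply: off_leq; lia|lia].
Qed.

Lemma off_ltr i j i' j' : 1 <= i -> i < j -> 1 <= i' -> j < j' -> off i j < off i' j'.
Proof.
move=> i1 ij i1' jj'; apply: (@leq_trans (off j j)); first exact: off_ltl.
rewrite off_wrap; last lia.
apply: leq_trans (off_leq _ (leqnn 1) i1').
by apply: off_leq1; lia.
Qed.

(** The word runs through [c_2], [c_3], ... and through increasing [i] inside [c_j]; hence labels
    are ordered by [j] first. *)
Lemma off_lt i j i' j' : 1 <= i -> i < j -> 1 <= i' -> i' < j' ->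
  (off i j < off i' j') = ((j < j') || (j == j') && (i < i')).
Proof.
move=> i1 ij i1' ij'; case: (ltngtP j j') => [jj'|jj'|<-] /=; first exact: off_ltr.
  by apply/negbTE; rewrite -leqNgt ltnW// off_ltr.
case: (ltnP i i') => ii'; first exact: off_ltl.
by apply/negbTE; rewrite -leqNgt off_leq.
Qed.

Lemma off_inj i j i' j' : 1 <= i -> i < j -> 1 <= i' -> i' < j' ->
  off i j = off i' j' -> i = i' /\ j = j'.
Proof.
move=> i1 ij i1' ij' E.
have := off_lt i1 ij i1' ij'; have := off_lt i1' ij' i1 ij; rewrite E ltnn; lia.
Qed.

(** The infinite word as a function. The prefix [pw 1 d.+3] reaches beyond index [d] by [ltn_off1],
    so the default of [nth] does not occur. *)
Definition omega d := nth s (pw 1 d.+3) d.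

Lemma ltn_off1 d : d < off 1 d.+3.
Proof.
elim: d => [|d IH]; first by rewrite -off_wrap//; apply: leq_ltn_trans (off_lt_succ _ _).
by apply: leq_ltn_trans IH _; apply: off_ltr.
Qed.

Lemma pw_leq_cat i j N : 1 <= i -> i <= j -> 2 <= j -> j < N -> exists x, pw 1 N = pw i j ++ x.
Proof.
move=> i1 ij j2 jN.
have [x E] : exists x, pw j j = pw i j ++ x.
  by exists (cw i j j); rewrite /pw -catA -c_word_cat ?i1.
have [y E'] : exists y, pw 1 N = pw j j ++ y.
  rewrite pw_wrap// -(subnKC jN); elim: (N - j.+1) => [|k [y IH]].
    by exists [::]; rewrite addn0 cats0.
  exists (y ++ cw 1 (j.+1 + k) (j.+1 + k)); rewrite addnS -pw_wrap; last lia.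
  rewrite catA -IH /pw [cw 1 1 _]/c_word cats0 //.
by exists (x ++ y); rewrite E' E catA.
Qed.

Lemma nth_pw i j d : 1 <= i -> i <= j -> 2 <= j -> d < off i j -> nth s (pw i j) d = omega d.
Proof.
move=> i1 ij j2 dij.
have [x Ex] := @pw_leq_cat i j (maxn d.+4 j.+1) i1 ij j2 ltac:(lia).
have [y Ey] := @pw_leq_cat 1 d.+3 (maxn d.+4 j.+1) isT isT isT ltac:(lia).
transitivity (nth s (pw 1 (maxn d.+4 j.+1)) d); first by rewrite Ex nth_cat dij.
by rewrite Ey nth_cat ltn_off1.
Qed.

Lemma nth_pw_s i j d : 1 <= i -> i < j -> d <= off i j -> nth s (pw i j ++ [:: s]) d = omega d.
Proof.
move=> i1 ij dij; rewrite -(@nth_pw i.+1 j)//; try lia.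
  rewrite pwS// !nth_cat; case: ltnP => // h.
  have -> : d = size (pw i j) by apply/eqP; rewrite eqn_leq dij h.
  by rewrite subnn.
by apply: leq_ltn_trans dij _; exact: off_lt_succ.
Qed.

Lemma omega_off i j : 1 <= i -> i < j -> omega (off i j) = s.
Proof. by move=> i1 ij; rewrite -(nth_pw_s i1 ij)// nth_cat ltnn subnn. Qed.

Lemma omega_succ i j : 1 <= i -> i < j -> omega (off i.+1 j) = s.
Proof.
move=> i1; rewrite leq_eqVlt => /predU1P[<-|ij]; last exact: omega_off.
by rewrite off_wrap ?omega_off//; lia.
Qed.

Lemma off_succE i j : 1 <= i -> off i.+1 j = off i j + (size (rw i j)).+1.
Proof. by move=> i1; rewrite /off pwS// size_cat. Qed.

(** A block is followed by [s] even at the passage from [c_j] to [c_(j+1)], so it is delimited by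
    [s] on both sides. *)
Lemma omega_block i j d : 1 <= i -> i < j -> d <= (size (rw i j)).+1 ->
  omega (off i j + d) = nth s (s :: rw i j ++ [:: s]) d.
Proof.
move=> i1 ij; rewrite leq_eqVlt => /predU1P[->|dr].
  by rewrite -off_succE// omega_succ//= nth_cat ltnn subnn.
rewrite -(@nth_pw i.+1 j)//; try lia; last by rewrite off_succE// ltn_add2l.
rewrite pwS// nth_cat -/(off i j) ltnNge leq_addr addKn.
by rewrite -cat_cons [RHS]nth_cat ifT.
Qed.

(* u, read from position x on, agrees with omega, read from A on, on m + 1
   letters. *)
Definition agree (u : seq W) x A m :=
  x + m < size u /\ forall d, d <= m -> nth s u (x + d) = omega (A + d).

Lemma agree_sub u x A m x' A' m' : agree u x A m ->
  x <= x' -> x + A' = x' + A -> x' + m' <= x + m -> agree u x' A' m'.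
Proof.
move=> [xm h] xx' E le; split=> [|d dm]; first lia.
have -> : x' + d = x + (x' - x + d) by lia.
by rewrite h; [congr omega; lia|lia].
Qed.

Lemma agree_cat u x A m x' A' m' m'' : agree u x A m -> agree u x' A' m' ->
  x <= x' -> x' <= x + m -> x + A' = x' + A -> x + m'' <= x' + m' -> agree u x A m''.
Proof.
move=> [xm h] [xm' h'] xx' x'm E le; split=> [|d dm]; first lia.
have [dm'|dm'] := leqP d m; first exact: h.
have -> : x + d = x' + (x + d - x') by lia.
by rewrite h'; [congr omega; lia|lia].
Qed.

Lemma agree_slice u x A m : agree u x A m <->
  x + m < size u /\ drop x (take (x + m).+1 u) = mkseq (fun d => omega (A + d)) m.+1.
Proof.
split=> -[xm h]; split=> //.
  have sz : size (drop x (take (x + m).+1 u)) = m.+1 by rewrite size_drop size_takel; lia.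
  apply: (@eq_from_nth _ s); rewrite sz ?size_mkseq// => i im.
  by rewrite nth_drop nth_take ?nth_mkseq ?h//; lia.
move=> d dm; have := congr1 (fun z => nth s z d) h.
by rewrite nth_drop nth_take ?nth_mkseq//; lia.
Qed.

Lemma agree_blk u x i j : 1 <= i -> i < j ->
  agree u x (off i j) (size (rw i j)).+1 ->
  drop x (take (x + (size (rw i j)).+1).+1 u) = s :: rw i j ++ [:: s].
Proof.
move=> i1 ij /agree_slice[_ ->]; apply: (@eq_from_nth _ s).
  by rewrite size_mkseq -cat_cons size_cat addn1.
by move=> d; rewrite size_mkseq => dl; rewrite nth_mkseq// omega_block.
Qed.

Lemma nil_prefix_mkseq i j k l : 1 <= i -> i < j -> j < l -> 1 <= k -> k < l ->
  np i j k l ++ [:: s] = mkseq (fun d => omega (off i j + d)) (off k l - off i j).+1.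
Proof.
move=> i1 ij jl k1 kl.
have E : off i j + size (np i j k l) = off k l by rewrite /off -size_cat pw_nil_prefix.
apply: (@eq_from_nth _ s); first by rewrite size_mkseq size_cat /= addn1 -E addKn.
move=> d; rewrite size_cat addn1 ltnS => dn.
rewrite nth_mkseq; last by rewrite -E addKn.
rewrite -(nth_pw_s k1 kl) -?E ?leq_add2l// -(pw_nil_prefix k i1 ij jl) -catA.
by rewrite [RHS]nth_cat -/(off i j) ltnNge leq_addr addKn.
Qed.

(* The letters p and q of u are the ends of an (i,j,j,l)-gallery, in which k is
   the letter at which alpha_(i,l) is crossed. *)
Definition nil_triple u p q k i j l :=
  [/\ 1 <= i, i < j & j < l] /\
  [/\ p + off j l = q + off i j, p + off i l = k + off i j
    & agree u p (off i j) (off j l - off i j)].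

(** Passes between offset arithmetic and the gallery types used in [M_nil]. *)
Lemma nil_tripleP u p q k i j l : p <= q -> q < size u -> 1 <= i -> i < j -> j < l ->
  nil_triple u p q k i j l <->
  drop p (take q.+1 u) = np i j j l ++ [:: s] /\ k = p + size (np i j i l).
Proof.
move=> pq qu i1 ij jl; rewrite nil_prefix_mkseq//; try lia.
have o1 : off i j < off j l by apply: off_ltr; lia.
have o2 : off i j + size (np i j i l) = off i l.
  by rewrite /off -size_cat pw_nil_prefix.
split=> [[_ [Eq Ek /agree_slice[_ <-]]]|[Es ->]].
  by split; [congr (drop _ (take _.+1 _)); lia|lia].
have Eq : q = p + (off j l - off i j).
  by have := congr1 size Es; rewrite size_mkseq size_drop size_takel//; lia.
split=> //; split; [lia|lia|apply/agree_slice].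
by rewrite -Eq.
Qed.

Lemma nil_triple_off u p q k i j l : nil_triple u p q k i j l ->
  [/\ off i j < off i l, off i l < off j l, p < k, k < q & q < size u].
Proof.
move=> [[i1 ij jl] [E1 E2 [qu _]]].
have h1 : off i j < off i l by apply: off_ltr; lia.
have h2 : off i l < off j l by apply: off_ltl.
by split => //; lia.
Qed.

(** No label lies strictly between consecutive ones; by [off_wrap], [off i.+1 j] is the next
    position also when [i.+1 = j]. *)
Lemma off_succ_leq i j i' j' : 1 <= i -> i < j -> 1 <= i' -> i' < j' ->
  off i j < off i' j' -> off i.+1 j <= off i' j'.
Proof.
move=> i1 ij i1' ij'; rewrite off_lt// => /orP[jj'|/andP[/eqP<- ii']]; last exact: off_leq.
rewrite (leq_trans (off_leq j _ ij))// off_wrap; last lia.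
by apply: leq_trans (off_leq1 _ jj') (off_leq _ _ i1'); lia.
Qed.

(** [(c,d)] is the label preceding [(i',j')]; writing the next position as [off c.+1 d] covers the
    passage from [c_d] to [c_(d+1)]. *)
Lemma off_pred i j i' j' : 1 <= i -> i < j -> 1 <= i' -> i' < j' ->
  off i j < off i' j' ->
  exists c d, [/\ 1 <= c, c < d, off c.+1 d = off i' j' & off i j <= off c d].
Proof.
move=> i1 ij i1' ij' lt.
have [i'1|i'1] := leqP i' 1.
  have Ei : i' = 1 by lia.
  move: lt; rewrite off_lt// Ei => h.
  have j3 : 3 <= j' by lia.
  (* The letter labelled [(1,j')] is preceded by the last block of [c_(j'-1)], which has label
     [(j'-2,j'-1)]. *)
  exists j'.-2, j'.-1; split; [lia|lia| |].
    have -> : j'.-2.+1 = j'.-1 by lia.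
    by rewrite off_wrap; [congr off; lia|lia].
  rewrite leqNgt off_lt//; lia.
exists i'.-1, j'; split; [lia|lia|congr off; lia|].
by rewrite leqNgt off_lt//; move: lt; rewrite off_lt//; lia.
Qed.

(** The gallery contains the full blocks after [p] and after [k], so both labels can be read off to
    the right. *)
Lemma nil_triple_fwd u p q k i j l : nil_triple u p q k i j l ->
  agree u p (off i j) (off i.+1 j - off i j) /\ agree u k (off i l) (off i.+1 l - off i l).
Proof.
move=> T; have [h1 h2 _ _ _] := nil_triple_off T; case: T => -[i1 ij jl] [E1 E2 h].
have a1 : off i.+1 j <= off i l by apply: off_succ_leq => //; lia.
have a2 : off i.+1 l <= off j l by apply: off_leq.
have a3 := off_lt_succ j i1; have a4 := off_lt_succ l i1.
by split; apply: (agree_sub h); lia.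
Qed.

(** The prefix ending at [alpha_(N-1,N)] contains all triples with labels up to [N]; it serves as
    the witness for the lower bound on the class. *)
Lemma pred_triple N i j l : 1 <= i -> i < j -> j < l -> l <= N ->
  nil_triple (pw N.-1 N ++ [:: s]) (off i j) (off j l) (off i l) i j l.
Proof.
move=> i1 ij jl lN.
have o1 : off i j < off j l by apply: off_ltr; lia.
have o2 : off j l <= off N.-1 N.
  by rewrite leqNgt off_lt//; lia.
split=> //; split; [lia|lia|split=> [|d dm]].
  by rewrite size_cat /= -/(off _ _); lia.
by rewrite nth_pw_s//; lia.
Qed.

Hypotheses (hrs : r != s) (hrt : r != t).

Lemma size_alt_word i : size (alt i) = i.
Proof. by rewrite size_map size_iota. Qed.

Lemma alt_word_r i : r \notin alt i.
Proof.
by apply/mapP => -[p _]; case: ifP => _ /eqP; [rewrite (negPf hrs)|rewrite (negPf hrt)].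
Qed.

Lemma split_first (x : W) (a a' b b' : seq W) : x \notin a -> x \notin a' ->
  a ++ x :: b = a' ++ x :: b' -> a = a' /\ b = b'.
Proof.
move=> xa xa' E; have := congr1 (index x) E.
rewrite !index_cat (negPf xa) (negPf xa') /= eqxx !addn0 => sa.
by move: E => /eqP; rewrite (eqseq_cat _ _ sa) => /andP[/eqP-> /eqP[->]].
Qed.

Lemma r_word_cat i j x : rw i j ++ x = r :: alt i ++ r :: alt j ++ r :: x.
Proof. by rewrite /r_word -!catA. Qed.

(** After [x] the word continues with [r], [k_i], [r], [k_j], [r]. Alternating words contain no [r],
    so the letters [r] separate the two parts, whose lengths are [i] and [j]. *)
Lemma agree_fwd u x i j i' j' m m' : 1 <= i -> i < j -> 1 <= i' -> i' < j' ->
  off i.+1 j <= off i j + m -> off i'.+1 j' <= off i' j' + m' ->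
  agree u x (off i j) m -> agree u x (off i' j') m' -> i = i' /\ j = j'.
Proof.
move=> i1 ij i1' ij'; rewrite !off_succE// !leq_add2l => hm hm' h h'.
have dropE k l n : 1 <= k -> k < l -> (size (rw k l)).+1 <= n -> agree u x (off k l) n ->
    exists z, drop x u = s :: r :: alt k ++ r :: alt l ++ r :: z.
  move=> k1 kl hn /agree_sub g.
  have {}g := g x (off k l) _ (leqnn x) erefl (leq_add (leqnn x) hn).
  exists (s :: drop (x + (size (rw k l)).+1).+1 u).
  set N := (x + _).+1.
  have xN : x < size (take N u) by case: g => ? _; rewrite size_takel; lia.
  by rewrite -{1}(cat_take_drop N u) drop_cat xN agree_blk// cat_cons -catA r_word_cat.
have [z E] := dropE _ _ _ i1 ij hm h; have [z' E'] := dropE _ _ _ i1' ij' hm' h'.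
move: E'; rewrite E => -[/(split_first (alt_word_r _) (alt_word_r _))[E1]].
move=> /(split_first (alt_word_r _) (alt_word_r _))[E2 _].
by rewrite -(size_alt_word i) E1 -(size_alt_word j) E2 !size_alt_word.
Qed.

Lemma rev_alt_word_r i : r \notin rev (alt i).
Proof. by rewrite mem_rev alt_word_r. Qed.

(** Mirror image of [agree_fwd], by reversing the words up to the common right end. Here [(i,j)] and
    [(i',j')] label the last full blocks, not the starting letters. *)
Lemma agree_bwd u x A m x' A' m' i j i' j' : 1 <= i -> i < j -> 1 <= i' -> i' < j' ->
  A <= off i j -> A' <= off i' j' -> A + m = off i.+1 j -> A' + m' = off i'.+1 j' ->
  x + m = x' + m' ->
  agree u x A m -> agree u x' A' m' -> i = i' /\ j = j'.
Proof.
move=> i1 ij i1' ij' hA hA'; rewrite !off_succE// => hm hm' exm h h'.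
have takeE k l B n y : 1 <= k -> k < l -> B <= off k l ->
    B + n = off k l + (size (rw k l)).+1 -> agree u y B n ->
    exists z, take (y + n).+1 u = z ++ rw k l ++ [:: s].
  move=> k1 kl hB En /agree_sub g.
  have {}g := g (y + (off k l - B)) (off k l) (size (rw k l)).+1
    ltac:(lia) ltac:(lia) ltac:(lia).
  exists (rcons (take (y + (off k l - B)) u) s).
  rewrite cat_rcons; have := agree_blk k1 kl g => <-.
  have -> : y + (off k l - B) + (size (rw k l)).+1 = y + n by lia.
  rewrite -{1}(cat_take_drop (y + (off k l - B)) (take (y + n).+1 u)).
  by rewrite take_takel//; lia.
have [z E] := takeE _ _ _ _ _ i1 ij hA hm h.
have [z' E'] := takeE _ _ _ _ _ i1' ij' hA' hm' h'.
move: E'; rewrite -exm E => /(congr1 rev); rewrite /r_word !rev_cat -!catA.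
move=> -[/(split_first (rev_alt_word_r _) (rev_alt_word_r _))[E1]].
move=> /(split_first (rev_alt_word_r _) (rev_alt_word_r _))[E2 _].
rewrite -(size_alt_word i) -(size_rev (alt i)) E2.
by rewrite -(size_alt_word j) -(size_rev (alt j)) E1 !size_rev !size_alt_word.
Qed.

(** The block after [p] gives [(i,j)]; the distance to [q] then gives [l], and with it [k]. *)
Lemma nil_triple_fun u p q k i j l k' i' j' l' :
  nil_triple u p q k i j l -> nil_triple u p q k' i' j' l' ->
  [/\ i = i', j = j', l = l' & k = k'].
Proof.
move=> T T'; have [h1 _] := nil_triple_fwd T; have [h1' _] := nil_triple_fwd T'.
case: T T' => -[i1 ij jl] [E1 E2 _] [[i1' ij' jl'] [E1' E2' _]].
have [Ei Ej] : i = i' /\ j = j' by apply: (agree_fwd _ _ _ _ _ _ h1 h1') => //; lia.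
move: E1' E2'; rewrite -Ei -Ej => E1' E2'.
have [_ El] : j = j /\ l = l' by apply: (@off_inj j l j l'); lia.
by split=> //; move: E2'; rewrite -El; lia.
Qed.

(* The label of the letter k is determined by the block following it, since k
   lies strictly inside a gallery. *)
Lemma nil_triple_fwd_label u p q k i j l q' k' a b c :
  nil_triple u p q k i j l -> nil_triple u k q' k' a b c -> a = i /\ b = l.
Proof.
move=> T T'; have [_ h] := nil_triple_fwd T; have [h' _] := nil_triple_fwd T'.
case: T T' => -[i1 ij jl] _ [[i1' ij' jl'] _].
by apply: (agree_fwd _ _ _ _ _ _ h' h) => //; lia.
Qed.

(** Both galleries contain the full block that ends at [k]; reading it backwards fixes its label,
    hence that of the following letter [k]. *)
Lemma nil_triple_bwd_label u p q k i j l p' k' a b c :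
  nil_triple u p q k i j l -> nil_triple u p' k k' a b c -> b = i /\ c = l.
Proof.
move=> T T'; have [h1 h2 h3 h4 _] := nil_triple_off T.
have [h1' h2' h3' h4' _] := nil_triple_off T'.
case: T T' => -[i1 ij jl] [E1 E2 h] [[i1' ij' jl'] [E1' E2' h']].
have i1l : i < l by lia.
have b1 : 1 <= b by lia.
have [e [f [e1 ef Ef lef]]] := off_pred i1 ij i1 i1l h1.
have [e' [f' [e1' ef' Ef' lef']]] := off_pred i1' ij' b1 jl' (ltn_trans h1' h2').
suff [Ee Eff] : e = e' /\ f = f' by apply: off_inj; rewrite -?Ef -?Ef' ?Ee ?Eff//; lia.
have g : agree u p (off i j) (off i l - off i j) by apply: (agree_sub h); lia.
apply: (agree_bwd e1 ef e1' ef' lef lef' _ _ _ g h'); lia.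
Qed.

Definition bounded (n : option nat) l := if n is Some m then l <= m else true.

Definition nil_target n u p q k :=
  exists i j l, bounded n l /\ nil_triple u p q k i j l.

(** * The matrix action attached to the chain of a commutator letter *)

Section Chain.
Variables (u : seq W) (p0 i0 k0 : nat).
Hypothesis target : exists p q j, nil_triple u p q p0 i0 j k0.

(* x carries the label (a,b) in the chain of letters through p0, in which p0
   carries the label (i0,k0). *)
Definition label x a b :=
  [/\ 1 <= a, a < b, x + off i0 k0 = p0 + off a b
    & agree u (minn x p0) (minn (off a b) (off i0 k0)) (maxn x p0 - minn x p0)].

Lemma i0_bounds : 1 <= i0 /\ i0 < k0.
Proof. by case: target => p [q [j [[i1 ij jl] _]]]; lia. Qed.

Lemma label_fun x a b a' b' : label x a b -> label x a' b' -> a = a' /\ b = b'.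
Proof. by move=> [a1 ab E _] [a1' ab' E' _]; apply: off_inj => //; lia. Qed.

Lemma label_off_lt x y a b a' b' : label x a b -> label y a' b' ->
  (x < y) = (off a b < off a' b').
Proof. by move=> [_ _ E _] [_ _ E' _]; lia. Qed.

Lemma label_agree x y a b a' b' : label x a b -> label y a' b' -> x <= y ->
  agree u x (off a b) (y - x).
Proof.
move=> [_ _ E h] [_ _ E' h'] xy.
have [xp|px] := leqP x p0; have [yp|py] := leqP y p0.
- by apply: (agree_sub h); lia.
- have g : agree u x (off a b) (p0 - x) by apply: (agree_sub h); lia.
  have g' : agree u p0 (off i0 k0) (y - p0) by apply: (agree_sub h'); lia.
  by apply: (agree_cat g g'); lia.
- lia.
- by apply: (agree_sub h'); lia.
Qed.

(** A stretch that follows the infinite word from a labelled letter carries the labels along;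
    [label_left] does the same in the other direction. *)
Lemma label_right x y a b a' b' m : label x a b -> 1 <= a' -> a' < b' ->
  agree u x (off a b) m -> y + off a b = x + off a' b' -> x <= y -> y <= x + m ->
  label y a' b'.
Proof.
move=> [_ _ E h] a1 ab g E' xy ym; split=> //; first lia.
have [xp|px] := leqP x p0; have [yp|py] := leqP y p0.
- by apply: (agree_sub h); lia.
- by apply: (agree_sub g); lia.
- lia.
- have g' : agree u p0 (off i0 k0) (x - p0) by apply: (agree_sub h); lia.
  have g'' : agree u p0 (off i0 k0) (y - p0) by apply: (agree_cat g' g); lia.
  by apply: (agree_sub g''); lia.
Qed.

Lemma label_left x y a b a' b' m : label y a' b' -> 1 <= a -> a < b ->
  agree u x (off a b) m -> y + off a b = x + off a' b' -> x <= y -> y <= x + m ->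
  label x a b.
Proof.
move=> [_ _ E h] a1 ab g E' xy ym; split=> //; first lia.
have [xp|px] := leqP x p0; have [yp|py] := leqP y p0.
- have g' : agree u y (off a' b') (p0 - y) by apply: (agree_sub h); lia.
  have g'' : agree u x (off a b) (p0 - x) by apply: (agree_cat g g'); lia.
  by apply: (agree_sub g''); lia.
- by apply: (agree_sub g); lia.
- lia.
- by apply: (agree_sub h); lia.
Qed.

Lemma label_p0 : label p0 i0 k0.
Proof.
have [i1 ik] := i0_bounds; split=> //.
case: target => p [q [j T]]; have [? ? ? ? ?] := nil_triple_off T.
by case: T => _ [? ? h]; apply: (agree_sub h); lia.
Qed.

(** The labels of [x] in the chain and in the gallery are compared on a common block: the one after
    [x] if [x] is at or before [p0], the one before [x] otherwise. The gallery then carries the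
    labels to its ends. *)
Lemma label_triple x a b p q i j l : label x a b -> nil_triple u p q x i j l ->
  [/\ a = i, b = l, label p i j & label q j l].
Proof.
move=> L T; have [i1 ik] := i0_bounds.
have [Ea Eb] : a = i /\ b = l.
  have [p' [q' [j' T0]]] := target.
  have [_ hx] := nil_triple_fwd T; have [_ h0] := nil_triple_fwd T0.
  have [? ? ? ? ?] := nil_triple_off T; have [? ? ? ? ?] := nil_triple_off T0.
  case: L => a1 ab E h; case: T => -[i1' ij jl] [E1 E2 g].
  case: T0 => -[_ ij' jl'] [E1' E2' g'].
  have il : i < l by lia.
  have [xp|px|xp] := ltngtP x p0.
  - have lt : off a b < off i0 k0 by lia.
    have le := off_succ_leq a1 ab i1 ik lt.
    have h' : agree u x (off a b) (p0 - x) by apply: (agree_sub h); lia.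
    by apply: (agree_fwd a1 ab i1' il _ _ h' hx); lia.
  - have lt : off i0 k0 < off a b by lia.
    have [e [f [e1 ef Ef lef]]] := off_pred i1 ik a1 ab lt.
    have lt' : off i j < off i l by lia.
    have [e' [f' [e1' ef' Ef' lef']]] := off_pred i1' ij i1' il lt'.
    have h' : agree u p0 (off i0 k0) (x - p0) by apply: (agree_sub h); lia.
    have h'' : agree u p (off i j) (x - p) by apply: (agree_sub g); lia.
    have [Ee Eff] : e = e' /\ f = f'.
      by apply: (agree_bwd e1 ef e1' ef' lef lef' _ _ _ h' h''); lia.
    by apply: off_inj; rewrite -?Ef -?Ef' ?Ee ?Eff//; lia.
  - have [-> ->] : a = i0 /\ b = k0 by apply: off_inj => //; lia.
    rewrite xp in hx.
    by apply: (agree_fwd i1 ik i1' il _ _ h0 hx); lia.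
subst a b; case: (T) => -[i1' ij jl] [E1 E2 g].
have [? ? ? ? ?] := nil_triple_off T.
split=> //; first by apply: (label_left L i1' ij g); lia.
have g' : agree u x (off i l) (q - x) by apply: (agree_sub g); lia.
by apply: (label_right L _ jl g'); lia.
Qed.

(** Converse of [label_triple]: the stretch of the chain between labels [(a,b)] and [(b,c)] is
    itself an [(a,b,b,c)]-gallery. *)
Lemma label_compose p q a b c : label p a b -> label q b c ->
  exists2 k, nil_triple u p q k a b c & label k a c.
Proof.
move=> L L'; case: (L) => a1 ab E h; case: (L') => b1 bc E' h'.
have o1 : off a b < off a c by apply: off_ltr.
have o2 : off a c < off b c by apply: off_ltl.
have pq : p <= q by lia.
have g := label_agree L L' pq.
exists (p + (off a c - off a b)).
  by split=> //; split; [lia|lia|apply: (agree_sub g); lia].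
by apply: (label_right L a1 (ltn_trans ab bc) g); lia.
Qed.

(** The elementary matrix [1 + E_(a,b)] over [F_2], acting on column vectors. *)
Definition transv (a b : nat) (v : nat -> bool) : nat -> bool :=
  fun m => v m (+) ((m == a) && v b).

(* The letters labelled (a,b) with i0 <= a and b <= k0 act by elementary
   matrices, all other letters trivially; the entry at (i0,k0) then detects the
   letter p0. *)
Definition in_block x (ab : nat * nat) :=
  [/\ label x ab.1 ab.2, i0 <= ab.1 & ab.2 <= k0].

Definition block_act x : (nat -> bool) -> nat -> bool :=
  if pselect (exists ab, in_block x ab) is left e
  then transv (projT1 (cid e)).1 (projT1 (cid e)).2 else id.

Lemma block_act_in x a b : in_block x (a, b) -> block_act x = transv a b.
Proof.
move=> h; rewrite /block_act; case: pselect => [e|[]]; last by exists (a, b).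
by case: (cid e) => -[c d] [/= L _ _]; case: h => /= L' _ _; have [-> ->] := label_fun L L'.
Qed.

Lemma block_act_out x : ~ (exists ab, in_block x ab) -> block_act x = id.
Proof. by move=> h; rewrite /block_act; case: pselect. Qed.

Lemma transvK a b : a < b -> involutive (transv a b).
Proof.
move=> ab v; apply: funext => m; rewrite /transv; have -> : (b == a) = false by lia.
by case: (m == a); case: (v m); case: (v b).
Qed.

Lemma block_actK x : involutive (block_act x).
Proof.
have [[[a b] h]|h] := pselect (exists ab, in_block x ab); last by rewrite block_act_out.
by rewrite (block_act_in h); apply: transvK; case: h => -[].
Qed.

(** The commutator word of [p] and [q] applied from left to right; inverse letters act like the
    letters themselves. *)
Definition block_comm p q v := block_act q (block_act p (block_act q (block_act p v))).

Lemma block_comm_pp p v : block_comm p p v = v.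
Proof. by rewrite /block_comm !block_actK. Qed.

(** The matrices [1 + E_(a,b)] and [1 + E_(c,d)] commute unless [b = c] or [d = a]; the latter is
    impossible because [p < q] puts the label [(a,b)] before [(c,d)]. *)
Lemma block_comm_out p q v :
  ~ (exists a b c, in_block p (a, b) /\ in_block q (b, c)) -> p < q ->
  block_comm p q v = v.
Proof.
move=> h pq; rewrite /block_comm.
have [[[a b] hp]|hp] := pselect (exists ab, in_block p ab); last first.
  by rewrite (block_act_out hp) block_actK.
have [[[c d] hq]|hq] := pselect (exists ab, in_block q ab); last first.
  by rewrite (block_act_out hq) block_actK.
rewrite (block_act_in hp) (block_act_in hq).
have [/= L i0a bk0] := hp; have [/= L' i0c dk0] := hq.
have [a1 ab _ _] := L; have [c1 cd _ _] := L'.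
move: pq; rewrite (label_off_lt L L') off_lt// => lt.
have bc : (b == c) = false.
  by apply/negP => /eqP E; apply: h; exists a, b, d; rewrite {2}E.
apply: funext => m; rewrite /transv /= ?eqxx ?bc.
have -> : (b == a) = false by lia.
have -> : (d == a) = false by lia.
have -> : (d == c) = false by lia.
by case: (m == a); case: (m == c); case: (v m); case: (v b); case: (v d).
Qed.

Lemma block_comm_in p q a b c v : in_block p (a, b) -> in_block q (b, c) ->
  block_comm p q v = transv a c v.
Proof.
move=> hp hq; rewrite /block_comm (block_act_in hp) (block_act_in hq).
have [/= [a1 ab _ _] i0a bk0] := hp; have [/= [_ bc _ _] i0b ck0] := hq.
apply: funext => m; rewrite /transv /= ?eqxx.
have -> : (b == a) = false by lia.
have -> : (c == a) = false by lia.
have -> : (c == b) = false by lia.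
by case: (m == a); case: (m == b); case: (v m); case: (v b); case: (v c).
Qed.

(** The basis vector at [k0]: coordinate [i0] of its image is the matrix entry at [(i0,k0)]. *)
Definition unitv (m : nat) := m == k0.

(** An earlier letter of the block has [b < k0], as [b = k0] would force [a < i0]; so it fixes the
    basis vector. *)
Lemma foldl_block_lt (z : seq nat) : all (fun x => x < p0) z ->
  foldl (fun v x => block_act x v) unitv z = unitv.
Proof.
have [i1 ik] := i0_bounds; elim: z => //= x z IH /andP[xp zp].
suff -> : block_act x unitv = unitv by exact: IH.
have [[[a b] hx]|hx] := pselect (exists ab, in_block x ab); last by rewrite block_act_out.
rewrite (block_act_in hx); case: hx => /= L i0a bk0.
have [a1 ab _ _] := L.
move: xp; rewrite (label_off_lt L label_p0) off_lt// => h.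
apply: funext => m; rewrite /transv /unitv.
have -> : (b == k0) = false by lia.
by rewrite andbF addbF.
Qed.

(** A later letter of the block has [b = k0] and [a > i0], so it leaves coordinate [i0]
    unchanged. *)
Lemma foldl_block_gt (z : seq nat) v : all (fun x => p0 < x) z ->
  foldl (fun v x => block_act x v) v z i0 = v i0.
Proof.
have [i1 ik] := i0_bounds; elim: z v => //= x z IH v /andP[xp zp].
rewrite IH//.
have [[[a b] hx]|hx] := pselect (exists ab, in_block x ab); last by rewrite block_act_out.
rewrite (block_act_in hx); case: hx => /= L i0a bk0.
have [a1 ab _ _] := L.
move: xp; rewrite (label_off_lt label_p0 L) off_lt// => h.
rewrite /transv; have -> : (i0 == a) = false by lia.
by rewrite addbF.
Qed.

Lemma block_act_p0 : block_act p0 unitv i0 = true.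
Proof.
have [i1 ik] := i0_bounds.
rewrite (@block_act_in _ i0 k0); last by split=> //; exact: label_p0.
by rewrite /transv /unitv !eqxx; lia.
Qed.

Lemma unitv_i0 : unitv i0 = false.
Proof. by have [i1 ik] := i0_bounds; rewrite /unitv; lia. Qed.

Lemma mask_all (P : pred nat) (b : bitseq) (z : seq nat) : all P z -> all P (mask b z).
Proof. by move=> /allP h; apply/allP => x /mem_mask; exact: h. Qed.

Lemma foldl_block_mask (b : bitseq) : p0 < size b ->
  foldl (fun v x => block_act x v) unitv (mask b (iota 0 (size b))) i0 = nth false b p0.
Proof.
move=> pb; rewrite -{1}(cat_take_drop p0 b) (drop_nth false pb).
have -> : size b = p0 + (size b - p0.+1).+1 by lia.
rewrite iotaD mask_cat ?size_iota ?size_takel ?(ltnW pb)//= add0n foldl_cat.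
rewrite foldl_block_lt; last first.
  by apply: mask_all; apply/allP => x; rewrite mem_iota.
have gt : all (fun x => p0 < x) (mask (drop p0.+1 b) (iota p0.+1 (size b - p0.+1))).
  by apply: mask_all; apply/allP => x; rewrite mem_iota => /andP[].
by case: nth => /=; rewrite foldl_block_gt// ?block_act_p0 ?unitv_i0.
Qed.

Variable n : option nat.
Hypothesis target_bound : bounded n k0.

(** Since [c <= k0] and [k0] respects the bound [n], no commutator inside the block is cut off by
    the truncation. *)
Lemma block_compose p q a b c : in_block p (a, b) -> in_block q (b, c) ->
  exists2 k, nil_target n u p q k & in_block k (a, c).
Proof.
move=> [/= L i0a _] [/= L' _ ck0]; have [k T Lk] := label_compose L L'.
exists k; last by split.
exists a, b, c; split=> //; move: target_bound; rewrite /bounded; case: n => // m; lia.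
Qed.

Lemma nil_target_fun m p q k k' : nil_target m u p q k -> nil_target m u p q k' -> k = k'.
Proof.
move=> [i [j [l [_ T]]]] [i' [j' [l' [_ T']]]].
by have [] := nil_triple_fun T T'.
Qed.

(** If [p] and [q] lie in the block with composable labels, so does [k]; otherwise [k] lies outside
    by [label_triple], and both sides act trivially. *)
Lemma block_comm_target p q k v : nil_target n u p q k -> block_comm p q v = block_act k v.
Proof.
move=> T; have [[a [b [c [hp hq]]]]|h] :=
    pselect (exists a b c, in_block p (a, b) /\ in_block q (b, c)).
  have [k' T' hk] := block_compose hp hq.
  by rewrite (nil_target_fun T T') (block_act_in hk) (block_comm_in _ hp hq).
have [i [j [l [_ T']]]] := T; have [_ _ pk kq _] := nil_triple_off T'.
rewrite block_comm_out ?(ltn_trans pk)//.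
rewrite block_act_out// => -[[a b] [/= L i0a bk0]]; apply: h.
have [Ea Eb Lp Lq] := label_triple L T'; case: T' => -[i1 ij jl] _.
by exists i, j, l; split; split => //=; lia.
Qed.

Lemma block_comm_no_target p q v : p <= q -> ~ (exists k, nil_target n u p q k) ->
  block_comm p q v = v.
Proof.
rewrite leq_eqVlt => /predU1P[-> _|pq h]; first exact: block_comm_pp.
apply: block_comm_out => // -[a [b [c [hp hq]]]].
by have [k T _] := block_compose hp hq; apply: h; exists k.
Qed.

End Chain.

(** * Reducedness of the prefixes of the infinite word *)

Hypothesis hst : s != t.

Local Notation neq := (fun x y : W => x != y).

Lemma alt_word_path x m k : x != (if odd m then s else t) ->
  path neq x [seq if odd p then s else t | p <- iota m k].
Proof.
elim: k m x => //= k IH m x ->; apply: IH => /=.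
by case: (odd m); rewrite //= eq_sym.
Qed.

(** A word that may follow [r] without equal neighbours and returns to [r], or is empty; such words
    can be concatenated freely. *)
Definition r_loop z := path neq r z && (last r z == r).

Lemma r_loop_cat z z' : r_loop z -> r_loop z' -> r_loop (z ++ z').
Proof.
by move=> /andP[pz /eqP lz] /andP[pz' lz']; rewrite /r_loop cat_path last_cat pz lz pz'.
Qed.

Lemma r_loop_flatten (zs : seq (seq W)) : all r_loop zs -> r_loop (flatten zs).
Proof.
elim: zs => [_|z zs IH /andP[rz /IH]]; first by rewrite /r_loop /= eqxx.
exact: r_loop_cat.
Qed.

Lemma r_loop_alt i z : 1 <= i -> r_loop z -> r_loop (alt i ++ r :: z).
Proof.
move=> i1 /andP[pz lz]; rewrite /r_loop cat_path last_cat /= lz pz !andbT.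
rewrite alt_word_path //=; case: i i1 => // i _ /=.
apply/negP => /eqP E; have := alt_word_r i.+1.
by rewrite -{1}E mem_last.
Qed.

Lemma r_loop_block i j : 1 <= i -> i < j -> r_loop (s :: rw i j).
Proof.
move=> i1 ij; rewrite /r_loop /= hrs eq_sym hrs.
apply: r_loop_alt => //; apply: r_loop_alt => //; first lia.
by rewrite /r_loop /= eqxx.
Qed.

Lemma r_loop_c_word i j k : 1 <= i -> j <= k -> r_loop (cw i j k).
Proof.
move=> i1 jk; apply/r_loop_flatten/allP => _ /mapP[p + ->].
by rewrite mem_index_iota => /andP[ip pj]; apply: r_loop_block; lia.
Qed.

Lemma sorted_pw i j : i <= j -> sorted neq (pw i j ++ [:: s]).
Proof.
move=> ij; suff /andP[pz /eqP lz] : r_loop (pw i j).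
  by apply: (@path_sorted _ _ r); rewrite cat_path pz lz /= hrs.
apply: r_loop_cat; last exact: r_loop_c_word.
by apply/r_loop_flatten/allP => _ /mapP[p _ ->]; exact: r_loop_c_word.
Qed.

Lemma mem_pw i j x : x \in pw i j -> x \in [:: r; s; t].
Proof.
have alt_mem k : x \in alt k -> x \in [:: r; s; t].
  by move=> /mapP[p _ ->]; case: ifP; rewrite !inE eqxx ?orbT.
have cw_mem k l m : x \in cw k l m -> x \in [:: r; s; t].
  move=> /flattenP[_ /mapP[p _ ->]].
  rewrite in_cons => /predU1P[->|]; first by rewrite !inE eqxx orbT.
  rewrite /r_word !mem_cat => /or4P[|/alt_mem//||/orP[/alt_mem//|]];
    by rewrite inE => /eqP->; rewrite inE eqxx.
by rewrite mem_cat => /orP[/flattenP[_ /mapP[p _ ->]]|]; exact: cw_mem.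
Qed.

End NilWords.

(** * Reduced words, galleries and roots *)

Section UniversalCoxeter.
Local Open Scope classical_set_scope.
Local Open Scope group_scope.

Context (W : groupType) (S : {fset W}).
Hypotheses (hcox : coxeter_system S) (huniv : universal_type S).

Definition reduced (u : seq W) := all (mem S) u && sorted (fun x y => x != y) u.

Definition prodw (u : seq W) : W := \prod_(x <- u) x.

(** Left multiplication by the involution [x] on reduced words. It is stated for an [eqType] because
    it is applied to letters in [W] and in the subtype [S]. *)
Definition cons_red (T : eqType) (x : T) (u : seq T) :=
  if u is y :: u' then if x == y then u' else x :: u else [:: x].

Lemma prodw_nil : prodw [::] = 1. Proof. exact: big_nil. Qed.

Lemma prodw_cons x u : prodw (x :: u) = x * prodw u.
Proof. exact: big_cons. Qed.

Lemma prodw_cat u1 u2 : prodw (u1 ++ u2) = prodw u1 * prodw u2.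
Proof. exact: big_cat. Qed.

Lemma prodw_seq1 x : prodw [:: x] = x.
Proof. by rewrite prodw_cons prodw_nil mulg1. Qed.

Lemma prodw_rcons u x : prodw (rcons u x) = prodw u * x.
Proof. by rewrite -cats1 prodw_cat prodw_seq1. Qed.

Lemma invol s : s \in S -> s * s = 1.
Proof. by move=> sS; have [_ + _] := hcox.1 s sS; rewrite expg2. Qed.

Lemma invS s : s \in S -> s^-1 = s.
Proof. by move=> sS; apply: mulg1_eq; exact: invol. Qed.

Lemma reduced_cons x u : reduced (x :: u) =
  [&& x \in S, ohead u != Some x & reduced u].
Proof.
rewrite /reduced /=; case: u => [|y u] /=; first by rewrite !andbT.
rewrite -(inj_eq (@Some_inj _)) [Some x == _]eq_sym.
by case: (x \in S); case: (y \in S); case: (Some y == Some x); rewrite ?andbF.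
Qed.

Lemma cons_red_reduced s u : s \in S -> reduced u -> reduced (cons_red s u).
Proof.
move=> sS; case: u => [|y u] /=; first by rewrite reduced_cons sS.
case: eqVneq => [_|sy]; first by rewrite reduced_cons => /and3P[].
rewrite [reduced (s :: _)]reduced_cons sS /= => ->.
by rewrite (inj_eq (@Some_inj _)) eq_sym sy.
Qed.

Lemma cons_redE s (u : seq W) : ohead u != Some s -> cons_red s u = s :: u.
Proof.
by case: u => // y u /=; rewrite (inj_eq (@Some_inj _)) eq_sym => /negPf->.
Qed.

Lemma prodw_cons_red s u : s \in S -> prodw (cons_red s u) = s * prodw u.
Proof.
move=> sS; case: u => [|y u] /=; first by rewrite prodw_cons.
case: eqVneq => [<-|_]; last by rewrite !prodw_cons.
by rewrite prodw_cons mulgA invol ?mul1g.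
Qed.

(* van der Waerden's trick: the free product of groups of order 2 acts on
   reduced words, so that distinct reduced words represent distinct elements. *)
Lemma pres_eq_foldr (a b : word S) z : pres_eq (@coxeter_rel W S) a b ->
  sorted (fun x y : S => x != y) z ->
  foldr (@cons_red S) z [seq l.1 | l <- a] =
  foldr (@cons_red S) z [seq l.1 | l <- b].
Proof.
have hred (x : S) (u : seq S) : sorted (fun x y : S => x != y) u ->
    sorted (fun x y : S => x != y) (cons_red x u).
  case: u => //= y u; case: eqVneq => [_|xy] /=; first by move/path_sorted.
  by rewrite xy.
have hfold (c : seq S) (u : seq S) : sorted (fun x y : S => x != y) u ->
    sorted (fun x y : S => x != y) (foldr (@cons_red S) u c).
  by move=> su; elim: c => //= x c; exact: hred.
have hinv (x : S) (u : seq S) : sorted (fun x y : S => x != y) u ->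
    cons_red x (cons_red x u) = u.
  case: u => [|y u] /=; first by rewrite eqxx.
  case: eqVneq => [<-|xy] /=; last by rewrite eqxx.
  by case: u => //= y' u /andP[/negPf->].
move=> E; elim: E z => {a b}.
- move=> _ _ [s1 s2 m ord] z sz.
  (* In universal type only [s1 = s2] yields a relation; the product is then [1], of order [1]. *)
  have [E|/eqP neq] := eqVneq s1 s2; last first.
    case: (huniv (valP s1) (valP s2)); last by exists m.
    by apply: contra_notN neq => /eqP/val_inj.
  have -> : m = 1%N.
    case: ord => m0 _ /(_ 1%N isT); rewrite E expg1 (invol (valP s2)).
    by case: m m0 => [//|[//|m]] _ /(_ isT).
  by rewrite E /= hinv.
- by move=> x b z sz /=; rewrite hinv.
- by [].
- by move=> a b _ IH z /IH.
- by move=> a b c _ IH1 _ IH2 z sz; rewrite IH1 ?IH2.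
- move=> a a' b b' _ IH1 _ IH2 z sz.
  by rewrite !map_cat !foldr_cat IH2// IH1//; exact: hfold.
Qed.

Lemma pres_word (a : word S) (f : {multiplicative presented (@coxeter_rel W S) -> W}) :
  (forall s : S, f (pres_class _ [:: wgen s]) = val s) ->
  f (pres_class _ a) = prodw [seq val l.1 | l <- a].
Proof.
move=> fS.
have f1 : f (pres_class _ [::]) = 1.
  by apply: (@mulgI _ (f (pres_class _ [::]))); rewrite -gmulfM !mulg1.
elim: a => [|[x b] a IH] /=; first by rewrite prodw_nil.
rewrite -cat1s pres_classM gmulfM IH prodw_cons; congr (_ * _).
case: b; last exact: fS.
apply: (@mulgI _ (val x)); rewrite invol ?(valP x)// -{1}fS -gmulfM -[X in f X = _]pres_classM.
by rewrite -f1; congr (f _); apply/pres_classP; exact: (pres_eq_inv _ x false).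
Qed.

(** A reduced word is recovered by letting it act on the empty word, and this action depends only on
    the element represented. *)
Lemma reduced_inj u1 u2 : reduced u1 -> reduced u2 -> prodw u1 = prodw u2 ->
  u1 = u2.
Proof.
case: hcox => _ [f fbij fS].
have lift u : reduced u -> exists2 c : seq S,
    sorted (fun x y : S => x != y) c & [seq val x | x <- c] = u.
  case/andP => uS; rewrite -(map_id u); elim: u uS => [_ _|x u IH].
    by exists [::].
  case/andP=> xS uS /=; rewrite map_id => xu.
  have [|c sc cu] := IH uS; first by rewrite map_id (path_sorted xu).
  exists ((FSetSub xS) :: c) => /=; last by rewrite cu map_id.
  move: cu; rewrite map_id => cu; move: xu; rewrite -cu.
  by case: (c) sc => //= y c' ->; rewrite andbT => /andP[+ _]; apply: contra => /eqP <-.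
have fold (c : seq S) : sorted (fun x y : S => x != y) c ->
    foldr (@cons_red S) [::] [seq l.1 | l <- [seq wgen x | x <- c]] = c.
  rewrite -map_comp; elim: c => //= x c IH xc.
  rewrite IH ?(path_sorted xc)//.
  by case: (c) xc => //= y c' /andP[/negPf->].
move=> /lift[c1 s1 <-] /lift[c2 s2 <-] E; congr map.
rewrite -(fold c1)// -(fold c2)//; apply: pres_eq_foldr => //.
apply/pres_classP/(bij_inj fbij); rewrite !(pres_word _ fS).
by rewrite -!map_comp.
Qed.

Lemma foldr_cons_red u : all (mem S) u ->
  reduced (foldr (@cons_red W) [::] u) /\
  prodw (foldr (@cons_red W) [::] u) = prodw u.
Proof.
elim: u => [//|x u IH] /= /andP[xS /IH[ru pu]].
by split; rewrite ?cons_red_reduced ?prodw_cons_red ?pu ?prodw_cons.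
Qed.

Lemma reduced_exists w : exists u, reduced u /\ prodw u = w.
Proof.
case: hcox => _ [f [g fg gf] fS].
pose c := [seq val l.1 | l <- repr (g w)].
have cS : all (mem S) c by apply/allP => _ /mapP[l _ ->]; exact: valP.
exists (foldr (@cons_red W) [::] c); have [-> ->] := foldr_cons_red cS; split=> //.
by rewrite -(pres_word _ fS) pres_class_repr.
Qed.

Definition nw w : seq W := xget [::] [set u | reduced u /\ prodw u = w].

Lemma nwP w : reduced (nw w) /\ prodw (nw w) = w.
Proof. exact: xgetPex (reduced_exists w). Qed.

Lemma nw_reduced w : reduced (nw w). Proof. by case: (nwP w). Qed.

Lemma nwK w : prodw (nw w) = w. Proof. by case: (nwP w). Qed.

Lemma nw_prodw u : reduced u -> nw (prodw u) = u.
Proof. by move=> ru; apply: reduced_inj; rewrite ?nwK ?nw_reduced. Qed.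

Lemma nw1 : nw 1 = [::].
Proof. by rewrite -prodw_nil nw_prodw. Qed.

Lemma nw_mulS s w : s \in S -> nw (s * w) = cons_red s (nw w).
Proof.
move=> sS; rewrite -{1}(nwK w) -prodw_cons_red// nw_prodw//.
by apply: cons_red_reduced; rewrite ?nw_reduced.
Qed.

Lemma nw_foldr u : all (mem S) u -> nw (prodw u) = foldr (@cons_red W) [::] u.
Proof. by move=> /foldr_cons_red[ru <-]; exact: nw_prodw. Qed.

Lemma size_cons_red s (u : seq W) : (size (cons_red s u) <= (size u).+1)%N.
Proof. by case: u => //= y u; case: ifP => //= _; lia. Qed.

Lemma size_foldr_cons_red u : (size (foldr (@cons_red W) [::] u) <= size u)%N.
Proof. by elim: u => //= x u IH; apply: leq_trans (size_cons_red _ _) _. Qed.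

Lemma size_nw u : all (mem S) u -> (size (nw (prodw u)) <= size u)%N.
Proof. by move=> uS; rewrite nw_foldr// size_foldr_cons_red. Qed.

(** Each step of the reduction adds at most one letter, so full length means that nothing was
    cancelled. *)
Lemma size_nw_eq u : all (mem S) u -> size (nw (prodw u)) = size u -> reduced u.
Proof.
move=> uS; rewrite nw_foldr// => E.
suff <- : foldr (@cons_red W) [::] u = u by case: (foldr_cons_red uS).
elim: u E {uS} => //= x u IH; set v := foldr _ _ _ in IH *.
move=> E; have := size_cons_red x v; have := size_foldr_cons_red u.
rewrite -/v E ltnS => h1 h2; have {}IH : v = u by apply: IH; apply/eqP; rewrite eqn_leq h1.
move: E; rewrite IH; case: (u) => //= y u'; case: ifP => // _ /esym/eqP.
by move=> /eqP; lia.
Qed.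

Lemma lenE w : len S w = size (nw w).
Proof.
apply: xget_unique.
  split; first by exists (nw w); have [/andP[-> _] pw] := nwP w.
  by move=> m [u [uS <- <-]]; exact: size_nw.
move=> n [[u [uS <- pu]] h]; apply/eqP; rewrite eqn_leq.
rewrite h /=; last by exists (nw w); have [/andP[-> _] pw] := nwP w.
by rewrite -pu size_nw.
Qed.

(** * Roots as directed edges of the tree *)

Lemma simple_rootE s w : s \in S ->
  simple_root S s w <-> ohead (nw w) <> Some s.
Proof.
move=> sS; rewrite /simple_root /= !lenE nw_mulS//.
case: (nw w) => [|y u] /=; first by split.
case: eqVneq => [->|sy] /=; first by split; [lia|case].
by split => // _ [ys]; rewrite ys eqxx in sy.
Qed.

Definition hroot v s := translate v (simple_root S s).

Lemma translateE v (a : set W) w : translate v a w <-> a (v^-1 * w).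
Proof.
split=> [[x ax <-]|aw]; first by rewrite mulKg.
by exists (v^-1 * w); rewrite ?mulVKg.
Qed.

Lemma translate_hroot v w s : translate v (hroot w s) = hroot (v * w) s.
Proof.
apply/predeqP => x; split=> [/translateE/translateE|/translateE]; rewrite ?invgM -?mulgA.
  by move=> h; apply/translateE; rewrite invgM -mulgA.
by move=> h; do 2!apply/translateE.
Qed.

Lemma hrootE v s w : s \in S -> hroot v s w <-> ohead (nw (v^-1 * w)) <> Some s.
Proof.
move=> sS; split=> [/translateE/(simple_rootE _ sS)//|h].
by apply/translateE/simple_rootE.
Qed.

Lemma hroot_root v s : s \in S -> cox_root S (hroot v s).
Proof. by move=> sS; exists v, s. Qed.

Lemma hroot_in v s : s \in S -> hroot v s v.
Proof. by move=> sS; apply/hrootE; rewrite // mulVg nw1. Qed.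

Lemma hroot_out v s : s \in S -> ~ hroot v s (v * s).
Proof.
move=> sS; move=> /(hrootE _ _ sS); apply.
by rewrite mulKg -{1}(prodw_seq1 s) nw_prodw ?reduced_cons ?sS.
Qed.

Lemma all_mem_rcons u x : all (mem S) (rcons u x) = (x \in S) && all (mem S) u.
Proof. exact: all_rcons. Qed.

(** Right multiplication by a letter changes a normal form only at its end, so the first letter can
    become [x] only if the word was empty. *)
Lemma nw_mulr_head x y g : x \in S -> y \in S -> ohead (nw g) <> Some x ->
  ohead (nw (g * y)) = Some x -> g = 1 /\ x = y.
Proof.
move=> xS yS; rewrite -{2 3}(nwK g); have := nw_reduced g.
move E: (nw g) => u ru; case: u ru E => [_ E|z u ru E].
  rewrite prodw_nil mul1g -{1}(prodw_seq1 y) nw_prodw ?reduced_cons ?yS//.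
  by move=> _ [->].
rewrite -prodw_rcons /= => zx.
have /andP[uS _] := ru.
rewrite nw_foldr/=; last by move: uS => /= /andP[-> uS]; rewrite all_mem_rcons yS.
move: ru; rewrite reduced_cons => /and3P[zS hd ru].
have Eu : foldr (@cons_red W) [::] (rcons u y) = nw (prodw u * y).
  by rewrite -prodw_rcons nw_foldr// all_mem_rcons yS; case/andP: ru.
rewrite Eu.
have [u0|u0] := eqVneq u [::].
  rewrite u0 prodw_nil mul1g -{1}(prodw_seq1 y) nw_prodw ?reduced_cons ?yS//=.
  by case: eqVneq => //= _ [] /(congr1 (@Some W)).
suff h : ohead (nw (prodw u * y)) != Some z by rewrite cons_redE.
have ru' : reduced (rcons u y) \/ exists u', u = rcons u' y.
  case/lastP: u ru u0 {E zx uS hd Eu} => // u' l ru _.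
  have [->|ly] := eqVneq l y; [by right; exists u'|left].
  move: ru; rewrite /reduced !all_mem_rcons yS /= => /andP[-> /=].
  by case: u' => [|a u'] /=; rewrite ?ly// !rcons_path last_rcons => ->.
case: ru' => [ru'|[u' uE]].
  by rewrite -prodw_rcons nw_prodw//; case: (u) u0 hd.
rewrite uE prodw_rcons -mulgA invol// mulg1 nw_prodw.
  by move: hd; rewrite uE; case: (u').
move: ru; rewrite uE /reduced all_mem_rcons => /andP[/andP[_ ->]] /=.
by case: (u') => //= a u''; rewrite rcons_path => /andP[].
Qed.

(** In the tree only one edge leads out of a root, namely the one from [v] to [v * x]. *)
Lemma root_unique c y v x : x \in S -> y \in S ->
  hroot v x c -> ~ hroot v x (c * y) -> v = c /\ x = y.
Proof.
move=> xS yS; move=> /(hrootE _ _ xS) hc hd.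
have {}hd : ohead (nw (v^-1 * c * y)) = Some x.
  by apply: contrapT => h; apply/hd/hrootE; rewrite ?mulgA.
by have [/mulg1_eq + ->] := nw_mulr_head xS yS hc hd; rewrite invgK.
Qed.

Lemma hroot_inj c y v x : x \in S -> y \in S -> hroot v x = hroot c y ->
  v = c /\ x = y.
Proof.
by move=> xS yS E; apply: root_unique => //; rewrite E; [exact: hroot_in|exact: hroot_out].
Qed.

Lemma crossed_rootE c y : y \in S -> crossed_root S c (c * y) = hroot c y.
Proof.
move=> yS; apply: xget_unique.
  by split; [exact: hroot_root|exact: hroot_in|exact: hroot_out].
by move=> _ [[v [x [xS ->]]] h1 h2]; have [-> ->] := root_unique xS yS h1 h2.
Qed.

(** * Galleries and the roots they cross *)

Definition gal (c : W) (u : seq W) : seq W := c :: scanl *%g c u.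

Fixpoint roots (c : W) (u : seq W) : seq (set W) :=
  if u is y :: u' then hroot c y :: roots (c * y) u' else [::].

Definition rt c u i : set W := nth set0 (roots c u) i.

Lemma gallery_typeK c u : gallery_type (gal c u) = u.
Proof. by apply: scanlK => x y; rewrite mulKg. Qed.

Lemma galE (G : seq W) : G <> [::] -> G = gal (head 1 G) (gallery_type G).
Proof.
case: G => //= c G _; congr (_ :: _); rewrite pairmapK// => x y.
by rewrite mulVKg.
Qed.

Lemma head_gal c u : head 1 (gal c u) = c. Proof. by []. Qed.

Lemma last_gal c u : last 1 (gal c u) = c * prodw u.
Proof.
rewrite /gal /=; elim: u c => [|x u IH] c /=; first by rewrite prodw_nil mulg1.
by rewrite IH prodw_cons mulgA.
Qed.

Lemma size_gal c u : size (gal c u) = (size u).+1.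
Proof. by rewrite /= size_scanl. Qed.

Lemma gallery_gal c u : gallery S (gal c u) <-> all (mem S) u.
Proof. by rewrite /gallery gallery_typeK; split=> [[]|]. Qed.

Lemma minimal_gal c u : minimal_gallery S (gal c u) <-> reduced u.
Proof.
rewrite /minimal_gallery last_gal head_gal size_gal mulKg lenE /=.
split=> [[/gallery_gal uS /size_nw_eq]|ru]; first exact.
by rewrite nw_prodw//; split=> //; apply/gallery_gal; case/andP: ru.
Qed.

Lemma minimalE (G : seq W) : minimal_gallery S G ->
  exists c u, G = gal c u /\ reduced u.
Proof.
move=> mG; have [[/galE GE _] _] := mG.
exists (head 1 G), (gallery_type G); split=> //.
by move: mG; rewrite GE gallery_typeK => /minimal_gal.
Qed.

Lemma crossed_roots_gal c u : all (mem S) u -> crossed_roots S (gal c u) = roots c u.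
Proof.
rewrite /=; elim: u c => //= x u IH c /andP[xS uS].
by rewrite crossed_rootE// IH.
Qed.

Lemma MinE (G : seq W) : Min S G -> exists2 u, reduced u & G = gal 1 u.
Proof. by move=> [/minimalE[c [u [-> ru]]] /= ->]; exists u. Qed.

Lemma Min_toE w (G : seq W) : Min_to S w G -> G = gal 1 (nw w).
Proof.
by move=> [/MinE[u ru ->]]; rewrite last_gal mul1g => <-; rewrite nw_prodw.
Qed.

Lemma Min_to_nw w : Min_to S w (gal 1 (nw w)).
Proof.
split; last by rewrite last_gal mul1g nwK.
by split=> //; apply/minimal_gal/nw_reduced.
Qed.

Lemma size_roots c u : size (roots c u) = size u.
Proof. by elim: u c => //= x u IH c; rewrite IH. Qed.

Lemma rtE c u i : (i < size u)%N -> rt c u i = hroot (c * prodw (take i u)) (nth 1 u i).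
Proof.
rewrite /rt; elim: u c i => // x u IH c [|i] /= iu; first by rewrite prodw_nil mulg1.
by rewrite IH// prodw_cons mulgA.
Qed.

Lemma reduced_cat u1 u2 : reduced (u1 ++ u2) -> reduced u1 /\ reduced u2.
Proof.
rewrite /reduced all_cat => /andP[/andP[-> ->]] /=.
by move=> /cat_sorted2[-> ->].
Qed.

Lemma reduced_take i u : reduced u -> reduced (take i u).
Proof. by rewrite -{1}(cat_take_drop i u) => /reduced_cat[]. Qed.

Lemma reduced_drop i u : reduced u -> reduced (drop i u).
Proof. by rewrite -{1}(cat_take_drop i u) => /reduced_cat[]. Qed.

Lemma reduced_nth u i : reduced u -> (i < size u)%N -> nth 1 u i \in S.
Proof. by move=> /andP[/allP uS _] iu; apply/uS/mem_nth. Qed.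

Lemma take_prodw_inj u i j : reduced u -> (i <= size u)%N -> (j <= size u)%N ->
  prodw (take i u) = prodw (take j u) -> i = j.
Proof.
move=> ru iu ju /reduced_inj E.
have {}E := E (reduced_take _ ru) (reduced_take _ ru).
by have := congr1 size E; rewrite !size_takel.
Qed.

Lemma rt_inj c u i j : reduced u -> (i < size u)%N -> (j < size u)%N ->
  rt c u i = rt c u j -> i = j.
Proof.
move=> ru iu ju; rewrite !rtE// => /hroot_inj[||/mulgI E _].
- exact: reduced_nth.
- exact: reduced_nth.
- by apply: (take_prodw_inj ru _ _ (esym E)) || apply: (take_prodw_inj ru _ _ E); exact: ltnW.
Qed.

Lemma roots_uniq c u : reduced u -> uniq (roots c u).
Proof.
move=> ru; apply/(uniqP set0) => i j; rewrite !inE size_roots => iu ju.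
exact: (rt_inj ru iu ju).
Qed.

Lemma index_rt c u i : reduced u -> (i < size u)%N -> index (rt c u i) (roots c u) = i.
Proof. by move=> ru iu; rewrite index_uniq ?size_roots// roots_uniq. Qed.

Lemma rt_root c u i : reduced u -> (i < size u)%N -> cox_root S (rt c u i).
Proof. by move=> ru iu; rewrite rtE//; apply/hroot_root/reduced_nth. Qed.

(** Let [y], [z] be consecutive letters and [v] the chamber before [y]. If the normal form of
    [v^-1 * x] does not begin with [y], then that of [(v * y)^-1 * x] begins with [y], hence not
    with [z]. *)
Lemma rt_sub c u i j : reduced u -> (i <= j)%N -> (j < size u)%N ->
  rt c u i `<=` rt c u j.
Proof.
move=> ru; elim: j => [|j IH].
  by rewrite leqn0 => /eqP-> _; exact: subset_refl.
rewrite leq_eqVlt ltnS => /predU1P[-> _|ij ju]; first exact: subset_refl.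
apply: subset_trans (IH ij (ltnW ju)) _.
rewrite !rtE ?(ltnW ju)// => x.
have jS := reduced_nth ru (ltnW ju); have jS' := reduced_nth ru ju.
move=> /(hrootE _ _ jS) h; apply/(hrootE _ _ jS').
rewrite (take_nth 1) ?(ltnW ju)// prodw_rcons mulgA invgM invS// -mulgA nw_mulS//.
rewrite cons_redE; last exact/eqP.
move=> [E]; have /andP[_ su] := ru.
by have := sortedP 1 su j ju; rewrite E eqxx.
Qed.

(** A root containing [1] but not [w] is left at some step of the gallery to [w], and [root_unique]
    identifies it with the root crossed there. Conversely, crossed roots contain [1] because they
    are nested. *)
Lemma PhiE w a : Phi S w a <-> exists2 i, (i < size (nw w))%N & a = rt 1 (nw w) i.
Proof.
have rw := nw_reduced w; split=> [[[[v [x [xS ->]]] a1] aw]|[i iw ->]]; last first.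
  have iS := reduced_nth rw iw.
  split; first split; first exact: rt_root.
    apply: (@rt_sub 1 _ 0 _ rw _ iw) => //.
    rewrite rtE//; last exact: leq_ltn_trans iw.
    by rewrite take0 prodw_nil mulg1; apply/hroot_in/(reduced_nth rw)/(leq_ltn_trans _ iw).
  rewrite rtE// => /(hrootE _ _ iS); apply; rewrite mul1g.
  rewrite -{2}(nwK w) -{2}(cat_take_drop i (nw w)) prodw_cat mulKg.
  by rewrite nw_prodw ?reduced_drop// (drop_nth 1).
suff [i iw [h1 h2]] : exists2 i, (i < size (nw w))%N &
    hroot v x (prodw (take i (nw w))) /\ ~ hroot v x (prodw (take i (nw w)) * nth 1 (nw w) i).
  have [-> ->] := root_unique xS (reduced_nth rw iw) h1 h2.
  by exists i; rewrite // rtE// mul1g.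
move: aw; rewrite -{1}(nwK w) -{1}(take_size (nw w)).
move: (leqnn (size (nw w))); move: {1 3}(size (nw w)) => k.
elim: k => [_|i IH iw]; first by rewrite take0 prodw_nil.
have [ai|nai] := pselect (hroot v x (prodw (take i (nw w)))); last first.
  by move=> _; exact: IH (ltnW iw) nai.
by rewrite (take_nth 1)// prodw_rcons; exists i.
Qed.

Lemma translate_rt v c u i : (i < size u)%N -> translate v (rt c u i) = rt (v * c) u i.
Proof. by move=> iu; rewrite !rtE// translate_hroot mulgA. Qed.

Lemma drop_take_prodw u p q : (p <= q)%N ->
  (prodw (take p u))^-1 * prodw (take q u) = prodw (drop p (take q u)).
Proof.
move=> pq; apply: (@mulgI _ (prodw (take p u))).
by rewrite mulVKg -prodw_cat -(take_takel u pq) cat_take_drop.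
Qed.

Lemma rt_slice c u p q i : (p + i < q)%N -> (q <= size u)%N ->
  rt (c * prodw (take p u)) (drop p (take q u)) i = rt c u (p + i).
Proof.
move=> piq qu; rewrite !rtE ?size_drop ?size_takel; [|lia..].
rewrite nth_drop nth_take// take_drop take_takel; last lia.
by rewrite -mulgA -drop_take_prodw ?leq_addl// mulVKg addnC.
Qed.

Lemma ohead_roots c u : (0 < size u)%N -> ohead (roots c u) = Some (rt c u 0).
Proof. by case: u. Qed.

Lemma olast_roots c u : (0 < size u)%N ->
  ohead (rev (roots c u)) = Some (rt c u (size u).-1).
Proof.
rewrite /rt -(size_roots c u); case/lastP: (roots c u) => // R z _.
by rewrite size_rcons rev_rcons nth_rcons ltnn eqxx.
Qed.

(** The first and last crossed roots determine their edges, and only one reduced word leads from one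
    edge to the other. *)
Lemma gallery_betweenE c u p q (H : seq W) : reduced u -> (p <= q)%N -> (q < size u)%N ->
  gallery_between S H (rt c u p) (rt c u q) <->
  H = gal (c * prodw (take p u)) (drop p (take q.+1 u)).
Proof.
move=> ru pq qu; have pu := leq_ltn_trans pq qu; split; last first.
  set v := drop _ _ => ->.
  have sv : size v = (q - p).+1 by rewrite size_drop size_takel; lia.
  have rv : reduced v by apply/reduced_drop/reduced_take.
  have /andP[vS _] := rv.
  split; first exact/minimal_gal.
    by rewrite crossed_roots_gal// ohead_roots ?sv// rt_slice ?addn0//; lia.
  rewrite crossed_roots_gal// olast_roots ?sv//= rt_slice//; last lia.
  by rewrite subnKC.
move=> [/minimalE[e [v [-> rv]]]]; have /andP[vS _] := rv.
rewrite crossed_roots_gal//.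
have [v0|v0] := posnP (size v); first by rewrite (size0nil v0).
have lv : ((size v).-1 < size v)%N by rewrite prednK.
rewrite ohead_roots// olast_roots// => -[+] [].
rewrite !rtE// => /hroot_inj[||]; try exact: reduced_nth.
rewrite take0 prodw_nil mulg1 => -> _ /hroot_inj[||]; try exact: reduced_nth.
rewrite -mulgA => /mulgI E1 E2; congr gal; apply: reduced_inj => //.
  exact/reduced_drop/reduced_take.
rewrite -drop_take_prodw ?(leq_trans pq)// (take_nth 1)// prodw_rcons -E1 -E2 -mulgA.
by rewrite mulKg -prodw_rcons -take_nth// prednK// take_size.
Qed.

(** * The groups U_w *)

Section NilFamily.
Context (r s t : W).
Hypotheses (hr : r \in S) (hs : s \in S) (ht : t \in S).
Hypotheses (hrs : r != s) (hrt : r != t) (hst : s != t).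

Local Notation M := (M_nil S r s t).
Local Notation target := (nil_target r s t).

Lemma nil_target_bounds n u p q k : target n u p q k ->
  [/\ (p < k)%N, (k < q)%N & (q < size u)%N].
Proof. by move=> [i [j [l [_ /nil_triple_off[]]]]]. Qed.

(** Turns the family into a condition on positions in the type [u]; the base chamber [c] enters only
    through the roots. *)
Lemma M_nilE n c u p q G : reduced u -> (p <= q)%N -> (q < size u)%N ->
  M n G (rt c u p) (rt c u q) = [set x | exists2 k, target n u p q k & x = rt c u k].
Proof.
move=> ru pq qu; apply/predeqP => x; split.
  move=> [i [j [j' [l [H [[i1 ij j1 jl jl'] [_ tH] + [Ej hn] ->]]]]]].
  move=> /(gallery_betweenE _ _ ru pq qu) HE; subst j' H.
  move: tH; rewrite gallery_typeK => tH.
  have T : nil_triple r s t u p q (p + size (nil_prefix r s t i j i l)) i j l.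
    by apply/nil_tripleP.
  exists (p + size (nil_prefix r s t i j i l))%N.
    by exists i, j, l; split=> //; move: hn; rewrite /bounded; case: (n).
  have [_ _ _ kq _] := nil_triple_off T.
  have /andP[vS _] : reduced (drop p (take q.+1 u)) by apply/reduced_drop/reduced_take.
  rewrite /nil_root crossed_roots_gal// -[LHS]/(rt _ _ _) rt_slice//; lia.
move=> [k [i [j [l [hn T]]]] ->].
have [[i1 ij jl] _] := T.
have [tH Ek] := (nil_tripleP _ _ _ _ pq qu i1 ij jl).1 T.
have [_ _ _ kq _] := nil_triple_off T.
exists i, j, j, l, (gal (c * prodw (take p u)) (drop p (take q.+1 u))).
have /andP[vS _] : reduced (drop p (take q.+1 u)) by apply/reduced_drop/reduced_take.
split=> //.
- by split=> //; lia.
- by split; [apply/gallery_gal|rewrite gallery_typeK].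
- exact/(gallery_betweenE _ _ ru pq qu).
- by split=> //; move: hn; rewrite /bounded; case: (n).
- rewrite /nil_root crossed_roots_gal// -[RHS]/(rt _ _ _) rt_slice -?Ek//; lia.
Qed.

Lemma mem_crossed u a : reduced u -> a \in crossed_roots S (gal 1 u) ->
  exists2 p, (p < size u)%N & a = rt 1 u p.
Proof.
move=> ru; have /andP[uS _] := ru; rewrite crossed_roots_gal// => ar.
exists (index a (roots 1 u)); first by rewrite -(size_roots 1) index_mem.
by rewrite /rt nth_index.
Qed.

Lemma le_galleryE u a b : reduced u -> le_gallery S (gal 1 u) a b ->
  exists p q, [/\ (p <= q)%N, (q < size u)%N, a = rt 1 u p & b = rt 1 u q].
Proof.
move=> ru [/(mem_crossed ru)[p pu ->] /(mem_crossed ru)[q qu ->]].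
have /andP[uS _] := ru; rewrite crossed_roots_gal// !index_rt// => pq.
by exists p, q.
Qed.

Lemma M_nil_sub n G a b : index_set S G a b -> M n G a b `<=` open_interval S a b.
Proof.
move=> [/MinE[u ru ->] _ _ /(le_galleryE ru)[p [q [pq qu -> ->]]]].
rewrite M_nilE// => _ [k /nil_target_bounds[pk kq _] ->].
have ku := ltn_trans kq qu.
split; first split; first exact: rt_root.
- by move=> x [+ _]; apply: rt_sub => //; exact: ltnW.
- by move=> x [_]; apply: contra_not; apply: rt_sub => //; exact: ltnW.
move=> [] /rt_inj E; have := E ru; lia.
Qed.

(** Translation moves the base chamber and keeps the type, on which alone the targets depend. *)
Lemma M_nil_weyl n : weyl_invariant S (M n).
Proof.
move=> w x G a b _ [[/MinE[u ru ->] _] _] /(le_galleryE ru)[p [q [pq qu -> ->]]] _ _.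
have pu := leq_ltn_trans pq qu.
rewrite !translate_rt// !M_nilE//; apply/predeqP => y; split.
  move=> [k T ->]; have [_ kq _] := nil_target_bounds T.
  exists (rt 1 u k); first by exists k.
  by rewrite translate_rt//; apply: ltn_trans qu.
move=> [_ [k T ->] <-]; have [_ kq _] := nil_target_bounds T.
by exists k => //; rewrite translate_rt//; apply: ltn_trans qu.
Qed.

(** * Normal forms and the order of [U_w] *)

Section UGroup.
Local Open Scope card_scope.
Variables (n : option nat) (w : W).
Local Notation u := (nw w).
Local Notation Uw := (U S (M n) w).
Local Notation Phiw := (Phi S w).

Lemma crossed_nw : crossed_roots S (gal 1 u) = roots 1 u.
Proof. by rewrite crossed_roots_gal//; have /andP[] := nw_reduced w. Qed.

Definition pos (a : Phiw) : nat := index (val a : set W) (roots 1 u).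

Lemma pos_rt (a : Phiw) : (pos a < size u)%N /\ rt 1 u (pos a) = val a.
Proof.
have [i iu Ea] := (PhiE w (val a)).1 (set_mem (valP a)).
by rewrite /pos Ea index_rt// nw_reduced.
Qed.

Lemma pos_inj : injective pos.
Proof.
by move=> a b E; apply: val_inj; rewrite -(pos_rt a).2 E (pos_rt b).2.
Qed.

Lemma pos_surj p : (p < size u)%N -> exists a : Phiw, pos a = p.
Proof.
move=> pu; have Pa : rt 1 u p \in Phiw by apply/mem_set/PhiE; exists p.
by exists (exist _ (rt 1 u p) Pa); rewrite /pos index_rt// nw_reduced.
Qed.

Lemma M_nil_pos G (a b : Phiw) : (pos a <= pos b)%N -> M n G (val a) (val b) =
  [set x | exists2 k, target n u (pos a) (pos b) k & x = rt 1 u k].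
Proof.
have [_ <-] := pos_rt a; have [bu <-] := pos_rt b.
by move=> ab; rewrite M_nilE// nw_reduced.
Qed.

Lemma family_word_target (a b c : Phiw) : (pos a <= pos b)%N ->
  target n u (pos a) (pos b) (pos c) ->
  family_word S (M n) w (gal 1 u) (val a) (val b) = [:: c].
Proof.
move=> ab T; rewrite /family_word M_nil_pos// crossed_nw.
rewrite (@eq_in_filter _ _ (pred1 (val c))); last first.
  move=> x _ /=; apply/idP/eqP => [/set_mem[k T' ->]|->]; apply/mem_set||idtac.
    by rewrite (nil_target_fun hrs hrt T' T) (pos_rt c).2.
  by exists (pos c); rewrite ?(pos_rt c).2.
rewrite filter_pred1_uniq ?roots_uniq ?nw_reduced//=; first by rewrite valK.
by rewrite -index_mem size_roots; exact: (pos_rt c).1.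
Qed.

Lemma family_word_no_target (a b : Phiw) : (pos a <= pos b)%N ->
  ~ (exists k, target n u (pos a) (pos b) k) ->
  family_word S (M n) w (gal 1 u) (val a) (val b) = [::].
Proof.
move=> ab T; rewrite /family_word M_nil_pos// crossed_nw.
rewrite (@eq_in_filter _ _ pred0) ?filter_pred0// => x _ /=.
by apply/negP => /set_mem[k T' _]; apply: T; exists k.
Qed.

Lemma target_pos (a b : Phiw) k : target n u (pos a) (pos b) k -> exists c, pos c = k.
Proof. by move=> /nil_target_bounds[_ kq qu]; apply: pos_surj; apply: ltn_trans qu. Qed.

Lemma index_set_pos (a b : Phiw) : (pos a <= pos b)%N ->
  index_set S (gal 1 u) (val a) (val b).
Proof.
move=> ab; have [mG _] := Min_to_nw w.
have inr (c : Phiw) : val c \in roots 1 u.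
  by rewrite -index_mem size_roots; exact: (pos_rt c).1.
split=> //.
- by have [] := set_mem (valP a).
- by have [] := set_mem (valP b).
- by split; rewrite crossed_nw.
Qed.

Definition ugen (a : Phiw) : Uw := pres_class _ [:: wgen a].

Lemma ugen_sq a : ugen a * ugen a = 1.
Proof. by rewrite -pres_classM; apply/pres_classP/pres_eq_rel/U_rel_square. Qed.

Lemma ugen_comm a b : (pos a <= pos b)%N -> [~ ugen a, ugen b] =
  pres_class _ [seq wgen c | c <- family_word S (M n) w (gal 1 u) (val a) (val b)].
Proof.
move=> ab; rewrite pres_class_comm.
apply/pres_classP/pres_eq_rel; exact: (U_rel_comm (M n) (Min_to_nw w) (index_set_pos ab)).
Qed.

Lemma ugen_comm_target a b c : (pos a <= pos b)%N -> target n u (pos a) (pos b) (pos c) ->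
  [~ ugen a, ugen b] = ugen c.
Proof. by move=> ab T; rewrite ugen_comm// (family_word_target ab T). Qed.

Lemma ugen_comm_no_target a b : (pos a <= pos b)%N ->
  ~ (exists k, target n u (pos a) (pos b) k) -> [~ ugen a, ugen b] = 1.
Proof. by move=> ab T; rewrite ugen_comm// (family_word_no_target ab T). Qed.

(** Von Dyck's theorem for [U_w], with generators replaced by their positions; it is applied to the
    two kinds of action that detect coefficients. *)
Lemma U_eq_foldl (V : Type) (act : nat -> V -> V) :
  (forall p, involutive (act p)) ->
  (forall p q k v, target n u p q k ->
     act q (act p (act q (act p v))) = act k v) ->
  (forall p q v, (p <= q)%N -> ~ (exists k, target n u p q k) ->
     act q (act p (act q (act p v))) = v) ->
  forall z z' : seq Phiw,
    pres_class (@U_rel W S (M n) w) [seq wgen a | a <- z] =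
      pres_class _ [seq wgen a | a <- z'] ->
    forall v, foldl (fun v p => act p v) v [seq pos a | a <- z] =
              foldl (fun v p => act p v) v [seq pos a | a <- z'].
Proof.
move=> actK actT actN z z' /pres_classP E v.
have foldE y : foldl (fun v p => act p v) v [seq pos a | a <- y] =
    foldl (fun v l => act (pos l.1) v) v [seq wgen a | a <- y].
  by elim: y v => //= a y IH v0; rewrite IH.
rewrite !foldE.
apply: (pres_eq_foldl (act := fun a => act (pos a)) _ _ E) => [a|{E} a b ab v0].
  exact: actK.
case: ab => [c|G c d /Min_toE->]; first by rewrite /= actK.
move=> [_ _ _ /(le_galleryE (nw_reduced w))[p [q [pq qu Ec Ed]]]].
have ru := nw_reduced w; have pu := leq_ltn_trans pq qu.
have {Ec} Ec : pos c = p by rewrite /pos Ec index_rt.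
have {Ed} Ed : pos d = q by rewrite /pos Ed index_rt.
subst p q; have [[k T]|T] := pselect (exists k, target n u (pos c) (pos d) k).
  by have [e Ee] := target_pos T; subst k; rewrite (family_word_target pq T) /= (actT _ _ _ _ T).
by rewrite (family_word_no_target pq T) /= actN.
Qed.

Definition gens : seq Phiw := pmap insub (roots 1 u).

Lemma map_pos_gens : [seq pos a | a <- gens] = iota 0 (size u).
Proof.
have valg : [seq val a | a <- gens] = roots 1 u.
  rewrite /gens (pmap_filter (insubK _)); apply/all_filterP/allP => x xr.
  rewrite isSome_insub; apply/mem_set/PhiE; exists (index x (roots 1 u)).
    by rewrite -(size_roots 1) index_mem.
  by rewrite /rt nth_index.
have -> : [seq pos a | a <- gens] = [seq index x (roots 1 u) | x <- roots 1 u].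
  by rewrite -{2}valg -map_comp.
apply: (@eq_from_nth _ 0%N); rewrite size_map size_roots ?size_iota// => i iu.
rewrite (nth_map set0) ?size_roots// nth_iota// index_uniq ?size_roots//.
by rewrite roots_uniq// nw_reduced.
Qed.

Lemma size_gens : size gens = size u.
Proof. by rewrite -(size_map pos) map_pos_gens size_iota. Qed.

Lemma nth_gens (a : Phiw) : nth 1 [seq ugen c | c <- gens] (pos a) = ugen a.
Proof.
have au := (pos_rt a).1.
rewrite (nth_map a) ?size_gens//; congr ugen; apply: pos_inj.
by rewrite -(nth_map a 0%N) ?size_gens// map_pos_gens nth_iota.
Qed.

Lemma mask_gens_inj (b b' : bitseq) : size b = size u -> size b' = size u ->
  pres_class (@U_rel W S (M n) w) [seq wgen a | a <- mask b gens] =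
    pres_class _ [seq wgen a | a <- mask b' gens] -> b = b'.
Proof.
move=> sb sb' E; apply: (@eq_from_nth _ false); rewrite sb ?sb'// => p0 p0u.
(* If [p0] is a commutator, the matrices of its chain detect its bit. *)
have [[p [q [i [j [l [hl T]]]]]]|noT] := pselect (exists p q, target n u p q p0).
  have tg : exists p q j, nil_triple r s t u p q p0 i j l by exists p, q, j.
  have := @U_eq_foldl _ (block_act r s t u p0 i l) _ _ _ _ _ E (unitv l).
  rewrite !map_mask map_pos_gens.
  have foldb c : size c = size u -> foldl (fun v p => block_act r s t u p0 i l p v) (unitv l)
      (mask c (iota 0 (size u))) i = nth false c p0.
    by move=> sc; rewrite -sc (foldl_block_mask hrs hrt tg) ?sc.
  move=> H; rewrite -!foldb// H//.
  - exact: block_actK.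
  - by move=> x y k v Txy; exact: (block_comm_target hrs hrt tg hl).
  - by move=> x y v xy Txy; exact: (block_comm_no_target hrs hrt _ _ hl v xy Txy).
(* Otherwise the parity of the occurrences of [p0] is invariant, as no commutator relation has this
   letter on its right side. *)
have := @U_eq_foldl _ (fun p v => v (+) (p == p0)) _ _ _ _ _ E false.
rewrite !map_mask map_pos_gens.
have foldE z : uniq z -> foldl (fun v p => v (+) (p == p0)) false z = (p0 \in z).
  rewrite -[p0 \in z]addFb; elim: z false => [|x z IH] v /=; first by rewrite addbF.
  move=> /andP[xz /IH->]; rewrite in_cons eq_sym.
  by case: eqVneq xz => [->/negPf->|_ _] /=; rewrite ?addbF ?addbT.
have foldb c : size c = size u -> foldl (fun v p => v (+) (p == p0)) false
      (mask c (iota 0 (size u))) = nth false c p0.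
  move=> sc; rewrite foldE ?mask_uniq ?iota_uniq// in_mask ?iota_uniq//.
  rewrite mem_iota p0u /=; congr nth.
  by rewrite -[X in index X _](@nth_iota 0%N 0%N (size u) p0)// index_uniq ?size_iota ?iota_uniq.
move=> H; rewrite -!foldb// H//.
- by move=> p v; rewrite -addbA addbb addbF.
- move=> p q k v T; have -> : (k == p0) = false.
    by apply/negP => /eqP Ek; apply: noT; exists p, q; rewrite -Ek.
  by case: (p == p0); case: (q == p0); case: v.
- by move=> p q v _ _; case: (p == p0); case: (q == p0); case: v.
Qed.

Lemma ugen_subgroupT (P : set Uw) : subgroup P -> (forall a, P (ugen a)) -> P = setT.
Proof. exact: pres_subgroupT. Qed.

(** The ordered products form a subgroup containing the generators, since a commutator of two
    generators is trivial or a generator strictly between them. *)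
Lemma mask_gens_surj (z : Uw) : exists2 b : bitseq, size b = size u &
  pres_class _ [seq wgen a | a <- mask b gens] = z.
Proof.
set l := [seq ugen c | c <- gens].
have sl : size l = size u by rewrite size_map size_gens.
have : mask_prods l z.
  suff -> : mask_prods l = setT by [].
  apply: ugen_subgroupT => [|a]; last first.
    by apply/mask_prods_mem/(nthP 1); exists (pos a); rewrite ?sl ?(pos_rt a).1// nth_gens.
  apply: mask_prods_subgroup => [p|p q pq]; rewrite sl.
    by move=> /pos_surj[a <-]; rewrite nth_gens ugen_sq.
  move=> qu; have [a Ea] := pos_surj (ltn_trans pq qu); have [b Eb] := pos_surj qu.
  subst p q; rewrite !nth_gens.
  have [[k T]|T] := pselect (exists k, target n u (pos a) (pos b) k); last first.
    by left; rewrite ugen_comm_no_target// ltnW.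
  have [c Ec] := target_pos T; subst k; right; exists (pos c).
    by have [-> _ _] := nil_target_bounds T; exact: (pos_rt c).1.
  by rewrite nth_gens (ugen_comm_target (ltnW pq) T).
move=> [b]; rewrite sl => sb ->; exists b => //.
rewrite -map_mask; elim: (mask b gens) => [|a m IH]; first by rewrite big_nil.
by rewrite /= big_cons -IH -cat1s pres_classM.
Qed.

Lemma card_U : [set: Uw] #= `I_(2 ^ len S w).
Proof.
rewrite lenE -card_bool -card_tuple.
apply: (@card_setT_finType _ _ (fun b : (size u).-tuple bool =>
  pres_class (@U_rel W S (M n) w) [seq wgen a | a <- mask b gens])).
  by move=> b b' /mask_gens_inj E; apply/val_inj/E; rewrite size_tuple.
by move=> z; have [b /eqP sb <-] := mask_gens_surj z; exists (Tuple sb).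
Qed.

Lemma ugen_neq1 a : ugen a <> 1.
Proof.
move=> E; pose b := [seq p == pos a | p <- iota 0 (size u)].
have sb : size b = size u by rewrite size_map size_iota.
have au := (pos_rt a).1.
suff /(congr1 (fun b => nth false b (pos a))) : b = nseq (size u) false.
  by rewrite nth_nseq au (nth_map 0%N) ?size_iota// nth_iota// eqxx.
apply: mask_gens_inj; rewrite ?size_nseq// mask_false.
suff -> : mask b gens = [:: a] by [].
have -> : mask b gens = filter (pred1 a) gens.
  rewrite filter_mask; congr mask; rewrite /b -map_pos_gens -map_comp.
  by apply: eq_map => c /=; rewrite (inj_eq pos_inj).
rewrite filter_pred1_uniq//; first by rewrite -(map_inj_uniq pos_inj) map_pos_gens iota_uniq.
by rewrite -(mem_map pos_inj) map_pos_gens mem_iota.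
Qed.

End UGroup.

(** * The nilpotency class *)

Definition weight_ge m w d p := d = 0%N \/ exists p' q' i j l,
  [/\ (l <= m)%N, nil_triple r s t (nw w) p' q' p i j l & (d < l - i)%N].

(* Weights add up under commutators, because the labels of a letter in the
   galleries it lies strictly inside of and in those it bounds coincide. *)
Lemma weight_ge_target m w d p q k : target (Some m) (nw w) p q k ->
  weight_ge m w d p \/ weight_ge m w d q -> weight_ge m w d.+1 k.
Proof.
move=> [i [j [l [lm T]]]] h; right; exists p, q, i, j, l; split=> //.
case: (T) => -[i1 ij jl] _.
case: h => -[->|[p' [q' [i' [j' [l' [_ T' lt]]]]]]]; try lia.
  by have [-> El] := nil_triple_fwd_label hrs hrt T' T; lia.
by have [Ei ->] := nil_triple_bwd_label hrs hrt T' T; lia.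
Qed.

(** The generators of weight at least [d] form [Y d]. The subgroups they generate are a central
    filtration, because commutation with any generator raises the weight. *)
Lemma nilpotent_U m w : (2 <= m)%N -> nilpotent_class_le (U S (M (Some m)) w) (m - 1).
Proof.
move=> m2.
pose Y d := [set x | exists2 a : Phi S w, weight_ge m w d (pos a) & x = ugen (Some m) a].
have sY d : Y d.+1 `<=` Y d.
  move=> _ [a h ->]; exists a => //; case: h => // -[p [q [i [j [l [lm T lt]]]]]].
  by right; exists p, q, i, j, l; split=> //; apply: ltnW.
have Xgen P : subgroup P -> [set ugen (Some m) a | a in [set: Phi S w]] `<=` P -> P = setT.
  by move=> sP XP; apply: ugen_subgroupT => // a; apply: XP; exists a.
have cY d (a b : Phi S w) : weight_ge m w d (pos a) ->
    gen_subgroup (Y d.+1) [~ ugen (Some m) a, ugen (Some m) b].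
  move=> wa; have [N1 _ NV] := gen_subgroup_subgroup (Y d.+1).
  have comm (c e : Phi S w) : (pos c <= pos e)%N ->
      weight_ge m w d (pos c) \/ weight_ge m w d (pos e) ->
      gen_subgroup (Y d.+1) [~ ugen (Some m) c, ugen (Some m) e].
    move=> ce wce.
    have [[k T]|T] := pselect (exists k, target (Some m) (nw w) (pos c) (pos e) k).
      have [f Ef] := target_pos T; subst k; rewrite (ugen_comm_target ce T).
      by apply: gen_subgroup_incl; exists f => //; exact: weight_ge_target T wce.
    by rewrite ugen_comm_no_target.
  have [ab|/ltnW ba] := leqP (pos a) (pos b); first by apply: comm => //; left.
  (* The relations cover pairs in gallery order; the other order follows by inversion. *)
  by rewrite -invgR; apply: (NV); apply: comm => //; right.
have cN d x y : gen_subgroup (Y d) x -> gen_subgroup (Y d.+1) [~ x, y].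
  move: x y; apply: (comm_gen_subgroup Xgen) => //.
  - by move=> _ [a _ <-]; exact: ugen_sq.
  - by move=> _ _ [a wa ->] [b _ <-]; exact: cY.
  - by move=> _ _ /sY[a wa ->] [b _ <-]; exact: cY.
apply/seteqP; split=> [z /(@lower_central_sub _ (fun d => gen_subgroup (Y d)))|_ ->]; last first.
  by have [] := lower_central_subgroup (U S (M (Some m)) w) (m - 1).
move=> h; suff N1 : gen_subgroup (Y (m - 1)%N) `<=` [set 1].
  apply: (N1); apply: h => //.
  - apply: Xgen; first exact: gen_subgroup_subgroup.
    by move=> _ [a _ <-]; apply: gen_subgroup_incl; exists a => //; left.
  - by move=> d; exact: gen_subgroup_subgroup.
apply: (@gen_subgroup_min _ (Y (m - 1)%N) [set 1]).
  by split=> // [x y -> ->|x ->] /=; rewrite ?mulg1 ?invg1.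
(* From [1 <= i] and [l <= m] follows [l - i <= m - 1], so no letter has the weight [m - 1], which
   is positive as [2 <= m]. *)
move=> x [a wa _]; exfalso; case: wa => [|[p [q [i [j [l [lm [[i1 _ _] _] lt]]]]]]]; lia.
Qed.

(** For [N >= 3] this word is the type of a [(1,2,N-1,N)]-gallery, which crosses all [alpha_(i,j)]
    with [j <= N]. *)
Definition wpw N : W := prodw (pw r s t N.-1 N ++ [:: s]).

Lemma nw_wpw N : nw (wpw N) = pw r s t N.-1 N ++ [:: s].
Proof.
apply: nw_prodw; rewrite /reduced sorted_pw ?leq_pred// andbT.
apply/allP => x; rewrite mem_cat => /orP[/mem_pw|]; rewrite !inE.
  by case/or3P => /eqP->.
by move=> /eqP->.
Qed.

Lemma not_nilpotent_U n N : (2 <= N)%N -> bounded n N ->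
  ~ nilpotent_class_le (U S (M n) (wpw N)) (N - 2).
Proof.
move=> N2 nN nilp.
have posE i j : (1 <= i)%N -> (i < j)%N -> (j <= N)%N ->
    exists a : Phi S (wpw N), pos a = off r s t i j.
  move=> i1 ij jN; apply: pos_surj; rewrite nw_wpw size_cat addn1 ltnS.
  by rewrite leqNgt off_lt//; lia.
(* Induction by [u_(1,k+3) = [u_(1,k+2), u_(k+2,k+3)]]; since [lower_central] is indexed from 0, it
   starts with [u_(1,2)] in term 0. *)
suff H k (a : Phi S (wpw N)) : (k.+2 <= N)%N -> pos a = off r s t 1 k.+2 ->
    lower_central k (ugen n a).
  have [a Ea] := posE 1%N N isT ltac:(lia) (leqnn N).
  have := H (N - 2)%N a ltac:(lia); rewrite Ea => /(_ ltac:(by congr off; lia)).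
  by rewrite nilp => /ugen_neq1.
elim: k a => [//|k IH] a kN Ea.
have [b Eb] := posE 1%N k.+2 isT isT (ltnW kN).
have [c Ec] := posE k.+2 k.+3 isT (ltnSn _) kN.
apply: gen_subgroup_incl; exists (ugen n b), (ugen n c).
split; first exact: IH (ltnW kN) Eb.
rewrite (@ugen_comm_target n _ b c a)// Eb Ec ?Ea.
  by apply: ltnW; apply: off_ltr.
exists 1%N, k.+2, k.+3; split; first by move: nN; rewrite /bounded; case: (n) => // m; lia.
by rewrite nw_wpw; apply: pred_triple.
Qed.

(** (CB1) holds by reflexivity, as [M_nil] is constant in the gallery; the finite-order premise of
    (CB2) contradicts [huniv]. *)
Lemma M_nil_blueprint n : commutator_blueprint S (M n).
Proof.
split.
- exact: M_nil_sub.
- by [].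
- by move=> x y w G a b xS yS xy /(huniv xS yS xy).
- exact: card_U.
Qed.

End NilFamily.
End UniversalCoxeter.

Theorem theorem4p13 (W : groupType) (S : {fset W}) (r s t : W)
    (hcox : coxeter_system S) (huniv : universal_type S)
    (hrank : (3 <= #|` S|)%N)
    (hr : r \in S) (hs : s \in S) (ht : t \in S)
    (hrs : r != s) (hrt : r != t) (hst : s != t) :
  [/\ (* n in N u {oo}, with None for oo *)
      forall n : option nat,
        commutator_blueprint S (M_nil S r s t n) /\
        weyl_invariant S (M_nil S r s t n),
      forall n : nat, (3 <= n)%N ->
        (forall w : W, nilpotent_class_le (U S (M_nil S r s t (Some n)) w) (n - 1)) /\
        ~ (forall w : W, nilpotent_class_le (U S (M_nil S r s t (Some n)) w) (n - 2))
    & forall m : nat, exists w : W,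
        ~ nilpotent_class_le (U S (M_nil S r s t None) w) m].
Proof.
split=> [n|n n3|m].
- by split; [exact: M_nil_blueprint|exact: M_nil_weyl].
- split=> [w|/(_ (wpw r s t n))]; first by apply: nilpotent_U => //; exact: ltnW.
  by apply: not_nilpotent_U => //; [exact: ltnW|exact: leqnn].
(* With [N = m + 2] the excluded class [N - 2] is [m]. *)
- exists (wpw r s t m.+2).
  have h := @not_nilpotent_U W S hcox huniv r s t hr hs ht hrs hrt hst None.
  by have := h m.+2 isT isT; rewrite subn2.
Qed.
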